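(* Let $\{(\theta_t,r_t)\}$ be generated by AEGDM in the stochastic setting (defined in the context) with $0\le\mu<1$ and $\eta>0$. Suppose that: 1. (Smoothness) $f$ is $L$-smooth: $f(y)\le f(x)+\nabla f(x)^\top(y-x)+\frac L2\|y-x\|^2$ for all $x,y\in\mathbb{R}^n$. 2. (Independent samples) The random samples $\{\xi_t\}$ are independent. 3. (Unbiasedness) $\mathbb{E}_{\xi_t}[\nabla f(\theta_t;\xi_t)]=\nabla f(\theta_t)$ and $\mathbb{E}_{\xi_t}[f(\theta_t;\xi_t)]=f(\theta_t)$. 4. (Bounded variance) $\mathbb{E}_{\xi_t}[\|\nabla f(\theta_t;\xi_t)-\nabla f(\theta_t)\|^2]\le\sigma_g^2$ and $\mathbb{E}_{\xi_t}[|f(\theta_t;\xi_t)-f(\theta_t)|^2]\le\sigma_f^2$. Assume moreover that $\|\nabla f(\theta_t;\xi_t)\|\le G_\infty$ and $0<a\le f(\theta_t;\xi_t)+c\le B$ for all $t$. Let $\theta^*$ be a global minimizer of $f$. Then for all $T\ge1$, $$\min_i\mathbb{E}[r_{T,i}]\ge\max\left\{\sqrt{f(\theta^* )+c}-\eta D_1-\mu D_2-\sigma D_3,\;0\right\},$$ where $\sigma=\max\{\sigma_f,\sigma_g\}$ and $$D_1=\frac{L_F\,n\,(f(\theta_0)+c)}{(1-\mu)^2},\qquad D_2=\frac12\left(1+\frac1{(1-\mu)^2}\right)n\sqrt{f(\theta_0)+c},$$ $$D_3=\frac1{2a^{1/2}}+\sqrt{\frac{G_\infty^2}{4a^3}+\frac1a}\;\frac{\sqrt{f(\theta_0)+c}}{1-\mu}\sqrt{\eta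 nT},$$ $$L_F=\frac{1}{2\sqrt{f(\theta^* )+c}}\left(L+\frac{G_\infty^2}{2(f(\theta^* )+c)}\right).$$ Moreover, in the absence of noise (that is, when $f(\theta;\xi)=f(\theta)$ for all $\theta$ and $\xi$, so that the iteration is deterministic), with $r_i^*=\lim_{t\to\infty}r_{t,i}$, we have $$\min_i r_{T,i}>\min_i r_i^*>0\quad\text{if}\quad \eta D_1+\mu D_2<\sqrt{f(\theta^* )+c}.$$
   Context: Stochastic setting: $\xi$ is a random variable; for each value of $\xi$, $f(\cdot;\xi):\mathbb{R}^n\to\mathbb{R}$ is differentiable (possibly nonconvex) and bounded from below, and $c$ is a constant with $f(\theta;\xi)+c>0$ for all $\theta$ and $\xi$. Put $f(\theta)=\mathbb{E}_\xi[f(\theta;\xi)]$, a differentiable function. Let $\xi_0,\xi_1,\dots$ be random samples, each with the distribution of $\xi$. The initial point $\theta_0\in\mathbb{R}^n$ is deterministic. $\|\cdot\|$ is the Euclidean norm and $\partial_i$ is the $i$-th partial derivative in $\theta$. $\mathbb{E}_{\xi_t}$ denotes expectation over $\xi_t$ with $\theta_t$ held fixed (conditional on the past), and $\mathbb{E}$ denotes expectation over all samples; $\min_i$ is over $i\in\{1,\dots,n\}$. AEGDM with step size $\eta$ and momentum parameter $\mu$ is the iteration, for $t\ge0$ and $i\in\{1,\dots,n\}$, $$v_{t,i}=\frac{\partial_i f(\theta_t;\xi_t)}{2\sqrt{f(\theta_t;\xi_t)+c}},\qquad m_{t+1,i}=\mu m_{t,i}+v_{t,i},\quad m_{0,i}=0,$$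 $$r_{t+1,i}=\frac{r_{t,i}}{1+2\eta v_{t,i}^2},\quad r_{0,i}=\sqrt{f(\theta_0;\xi_0)+c},\qquad \theta_{t+1,i}=\theta_{t,i}-2\eta\, r_{t+1,i}m_{t+1,i}.$$
   Formalization: The strict inequality min_i r_{T,i} > min_i r_i^* fails for constant f; it is proved as ≥ in general and as > when some coordinate i attaining min_j r_{T,j} has ∂_i f(θ_t) ≠ 0 for some t ≥ T. *)

(* Defs.v *)
From mathcomp Require Import all_boot all_order all_algebra.
From mathcomp Require Import all_classical all_reals all_analysis.

Set Implicit Arguments.
Unset Strict Implicit.
Unset Printing Implicit Defensive.

Import Order.TTheory GRing.Theory Num.Theory numFieldNormedType.Exports.

Local Open Scope classical_set_scope.
Local Open Scope ring_scope.

(* The norm `|x| of the library on 'rV[R]_n is the sup norm, which induces the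
   same topology (hence the same notion of differentiability) as [enorm]. *)
Definition enorm (R : realType) (n : nat) (x : 'rV[R]_n) : R :=
  Num.sqrt (\sum_(i < n) x 0 i ^+ 2).

Definition dotv (R : realType) (n : nat) (x y : 'rV[R]_n) : R :=
  \sum_(i < n) x 0 i * y 0 i.

Definition partial (R : realType) (n : nat) (g : 'rV[R]_n -> R) (i : 'I_n)
    (x : 'rV[R]_n) : R :=
  'D_(delta_mx 0 i) g x.

Definition grad (R : realType) (n : nat) (g : 'rV[R]_n -> R) (x : 'rV[R]_n) :
    'rV[R]_n :=
  \row_i partial g i x.

Definition L_smooth (R : realType) (n : nat) (L : R) (g : 'rV[R]_n -> R) :
    Prop :=
  forall x y : 'rV[R]_n,
    g y <= g x + dotv (grad g x) (y - x) + L / 2 * enorm (y - x) ^+ 2.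

(* Minimum of the coordinates, taken in \bar R so that +oo can be the value for
   n = 0; for 0 < n it is the usual minimum. *)
Definition min_coord (R : realType) (n : nat) (x : 'I_n -> \bar R) : \bar R :=
  \big[Order.min/+oo%E]_(i < n) x i.

(* The product rule for events at finitely many pairwise distinct indices. *)
Definition mutually_independent (d d' : measure_display)
    (Omega : measurableType d) (Xi : measurableType d') (R : realType)
    (P : probability Omega R) (X : nat -> {mfun Omega >-> Xi}) : Prop :=
  forall (s : seq nat) (A : nat -> set Xi),
    uniq s -> (forall t, measurable (A t)) ->
    P (\bigcap_(t in [set` s]) (X t @^-1` A t)) =
    (\prod_(t <- s) P (X t @^-1` A t))%E.

Definition identically_distributed (d d' : measure_display)
    (Omega : measurableType d) (Xi : measurableType d') (R : realType)
    (P : probability Omega R) (X Y : {mfun Omega >-> Xi}) : Prop :=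
  forall A : set Xi, measurable A -> distribution P X A = distribution P Y A.

Definition mean_objective (d d' : measure_display)
    (Omega : measurableType d) (Xi : measurableType d') (R : realType) (n : nat)
    (P : probability Omega R) (xi : {mfun Omega >-> Xi})
    (f : 'rV[R]_n -> Xi -> R) (theta : 'rV[R]_n) : R :=
  fine ('E_P[fun w => f theta (xi w)])%E.

(* The AEGDM iteration along one sequence x of samples. *)
Record AEGDM (R : realType) (n : nat) (Xi : Type) (f : 'rV[R]_n -> Xi -> R)
    (c eta mu : R) (theta0 : 'rV[R]_n) (x : nat -> Xi)
    (theta r v m : nat -> 'rV[R]_n) : Prop := {
  AEGDM_theta0 : theta 0%N = theta0;
  AEGDM_r0 : forall i, r 0%N 0 i = Num.sqrt (f theta0 (x 0%N) + c);
  AEGDM_m0 : forall i, m 0%N 0 i = 0;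
  AEGDM_v : forall t i,
    v t 0 i = partial (f ^~ (x t)) i (theta t)
              / (2 * Num.sqrt (f (theta t) (x t) + c));
  AEGDM_m : forall t i, m t.+1 0 i = mu * m t 0 i + v t 0 i;
  AEGDM_r : forall t i, r t.+1 0 i = r t 0 i / (1 + 2 * eta * v t 0 i ^+ 2);
  AEGDM_theta : forall t i,
    theta t.+1 0 i = theta t 0 i - 2 * eta * r t.+1 0 i * m t.+1 0 i
}.

(* In the constants below, fc0 stands for f(theta_0) + c and fcs for
   f(theta^* ) + c. *)
Definition LF_const (R : realType) (L Ginf fcs : R) : R :=
  1 / (2 * Num.sqrt fcs) * (L + Ginf ^+ 2 / (2 * fcs)).

Definition D1_const (R : realType) (n : nat) (mu LF fc0 : R) : R :=
  LF * n%:R * fc0 / (1 - mu) ^+ 2.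

Definition D2_const (R : realType) (n : nat) (mu fc0 : R) : R :=
  1 / 2 * (1 + 1 / (1 - mu) ^+ 2) * n%:R * Num.sqrt fc0.

Definition D3_const (R : realType) (n T : nat) (eta mu a Ginf fc0 : R) : R :=
  1 / (2 * Num.sqrt a)
  + Num.sqrt (Ginf ^+ 2 / (4 * a ^+ 3) + 1 / a) * (Num.sqrt fc0 / (1 - mu))
    * Num.sqrt (eta * n%:R * T%:R).

(* Main.v *)
From HB Require Import structures.
Require Import Defs.
From mathcomp Require Import all_boot all_order all_algebra.
From mathcomp Require Import all_classical all_reals all_analysis.
From mathcomp Require Import measurable_realfun.
From mathcomp Require Import ring lra.

Set Implicit Arguments.
Unset Strict Implicit.
Unset Printing Implicit Defensive.

Import Order.TTheory GRing.Theory Num.Theory numFieldNormedType.Exports.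
Local Open Scope classical_set_scope.
Local Open Scope ring_scope.

(** The argument follows the square root [F = sqrt (fbar + c)] of the objective.
    As [fbar] is [L]-smooth and the square root is concave, [F] satisfies a
    descent inequality with curvature [L / (2 Fmin)], [Fmin] being the minimum of [F]
    ([sqrt_objective_descent]).  In coordinate [i] the first-order term of a step
    is [-2 eta dF_i r_(t+1) m_(t+1)].  If [dF_i] is replaced by [v_t] and
    [m_(t+1)] by [v_t], this is [-2 eta r_(t+1) v_t^2], which is exactly
    [r_(t+1) - r_t]: the descent of [F] is paid for by the energy, and summing
    over [t] telescopes.  Three errors remain:
    - the quadratic term and the momentum cross terms, controlled by the sums of
      [r_(t+1) v_t^2] and of [r_(t+1) m_(t+1)^2]; both are at most a multiple of
      [r_0], the second one because [m] is a geometric average of the [v_s] and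
      [r] decreases ([sum_momentum_le]).  They produce [eta D1] and [mu D2];
    - the noise [delta = v - dF], split off by Young's inequality with a free
      parameter ([coordinate_descent]).
    Since every energy decreases, each coordinate of [r_T - r_0] is at least their
    sum, which gives a bound from below, valid for every sample path, on each
    [r_(T,i)] ([AEGDM_descent]).

    Without noise this bound keeps the limits of the energies positive, and a
    nonzero partial derivative makes an energy drop strictly ([energy_drop]).
    With noise the bound is integrated.  The iterate [theta_t] is a function of
    [xi_0, ..., xi_(t-1)], so the pair ([theta_t], [xi_t]) can be integrated by
    first averaging over [xi_t] with [theta_t] held fixed: this is [freezing], a
    consequence of Tonelli's theorem once the joint law of the past and of [xi_t] is identified
    with a product measure.  It turns the conditional variance bounds into bounds
    on the mean of [delta^2], and it transfers the bound [a <= f + c] from the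
    samples to [a <= fbar + c] along the iterates.  The joint measurability it
    requires comes from continuity in [theta] and measurability in [xi]
    ([measurable_fun_caratheodory]).  Young's inequality takes the place of the
    Cauchy-Schwarz inequality, its parameter being chosen in
    [balanced_constants]; that choice divides by the noise level, so the bound is
    proved for every level above [sigma], and the level then tends to
    [sigma]. *)

(** * Energy and momentum of one coordinate *)

(* [sqr_ge0] has to be tried before [mulr_ge0], which would see a square as a
   product of two factors of unknown sign. *)
Ltac nonneg :=
  repeat first [ assumption | apply: sqr_ge0 | apply: exprn_ge0 | apply: ler0n
  | apply: mulr_ge0 | apply: addr_ge0 | rewrite invr_ge0 | by [] ].

Section CoordinateEnergy.
Context {R : realType}.
Variables (eta mu : R) (r v m : nat -> R).
Hypotheses (eta_gt0 : 0 < eta) (mu_ge0 : 0 <= mu) (mu_lt1 : mu < 1).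
Hypotheses (r0_gt0 : 0 < r 0%N) (m0 : m 0%N = 0).
Hypothesis mS : forall t, m t.+1 = mu * m t + v t.
Hypothesis rS : forall t, r t.+1 = r t / (1 + 2 * eta * v t ^+ 2).

Let denom_gt0 t : 0 < 1 + 2 * eta * v t ^+ 2.
Proof. have e0 := ltW eta_gt0; rewrite ltr_wpDr//; nonneg. Qed.

Lemma energy_gt0 t : 0 < r t.
Proof. by elim: t => // t IH; rewrite rS divr_gt0. Qed.

(** The update of [r] is the implicit one, [r_(t+1) (1 + 2 eta v_t^2) = r_t]; so
    the energy lost in a step is a squared gradient weighted by the new energy. *)
Lemma energy_drop t : 2 * eta * (r t.+1 * v t ^+ 2) = r t - r t.+1.
Proof.
have H : r t.+1 * (1 + 2 * eta * v t ^+ 2) = r t.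
  by rewrite rS divfK// gt_eqF.
by rewrite -[r t in RHS]H; ring.
Qed.

Lemma energy_nonincreasing : {homo r : s t / (s <= t)%N >-> t <= s}.
Proof.
apply/nonincreasing_seqP => t; rewrite -subr_ge0 -energy_drop.
have r_ge0 := ltW (energy_gt0 t.+1); have e_ge0 := ltW eta_gt0.
nonneg.
Qed.

Lemma sum_energy_drop T :
  2 * eta * \sum_(t < T) (r t.+1 * v t ^+ 2) = r 0%N - r T.
Proof.
rewrite mulr_sumr; under eq_bigr do rewrite energy_drop.
elim: T => [|T IH]; first by rewrite big_ord0 subrr.
by rewrite big_ord_recr/= IH; ring.
Qed.

(** Convexity of the square, [m_(t+1)] being the convex combination of [m_t] and
    of [v_t / (1 - mu)] with weights [mu] and [1 - mu]. *)
Lemma momentum_sq_le t : m t.+1 ^+ 2 <= mu * m t ^+ 2 + v t ^+ 2 / (1 - mu).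
Proof.
have mu1 : 0 < 1 - mu by rewrite subr_gt0.
rewrite mS -subr_ge0.
have -> : mu * m t ^+ 2 + v t ^+ 2 / (1 - mu) - (mu * m t + v t) ^+ 2 =
  mu / (1 - mu) * ((1 - mu) * m t - v t) ^+ 2.
  by field; rewrite gt_eqF.
by rewrite mulr_ge0 ?sqr_ge0// divr_ge0// ltW.
Qed.

(** Shifting the index of the momentum costs nothing because [m_0 = 0] and the
    energy decreases. *)
Lemma sum_momentum_shift T :
  \sum_(t < T) (r t.+1 * m t ^+ 2) + r T * m T ^+ 2 <=
  \sum_(t < T) (r t.+1 * m t.+1 ^+ 2).
Proof.
elim: T => [|T IH]; first by rewrite !big_ord0 m0 expr0n mulr0 addr0.
rewrite !big_ord_recr/= lerD2r (le_trans _ IH)// lerD2l.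
by rewrite ler_wpM2r ?sqr_ge0// energy_nonincreasing.
Qed.

(** If [S] is the momentum sum and [V] the sum of the [r_(t+1) v_t^2], the two
    previous lemmas give [S <= mu S + V / (1 - mu)], and [V] telescopes. *)
Lemma sum_momentum_le T :
  2 * eta * \sum_(t < T) (r t.+1 * m t.+1 ^+ 2) <= r 0%N / (1 - mu) ^+ 2.
Proof.
have mu1 : 0 < 1 - mu by rewrite subr_gt0.
set S := \sum_(t < T) _.
set V := \sum_(t < T) (r t.+1 * v t ^+ 2).
have SV : S <= mu * S + V / (1 - mu).
  have Sm : \sum_(t < T) (r t.+1 * m t ^+ 2) <= S.
    apply: le_trans (sum_momentum_shift T).
    by rewrite lerDl mulr_ge0 ?sqr_ge0// ltW// energy_gt0.
  apply: (@le_trans _ _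
    (mu * (\sum_(t < T) (r t.+1 * m t ^+ 2)) + V / (1 - mu))); last first.
    by rewrite lerD2r ler_wpM2l.
  rewrite mulr_sumr mulr_suml -big_split/=; apply: ler_sum => t _.
  have -> : mu * (r t.+1 * m t ^+ 2) + r t.+1 * v t ^+ 2 / (1 - mu) =
    r t.+1 * (mu * m t ^+ 2 + v t ^+ 2 / (1 - mu)) by ring.
  by rewrite ler_wpM2l ?momentum_sq_le// ltW// energy_gt0.
have {}SV : (1 - mu) ^+ 2 * S <= V.
  have : (1 - mu) * S <= V / (1 - mu) by lra.
  by rewrite ler_pdivlMr// expr2 mulrAC mulrC mulrA.
rewrite ler_pdivlMr ?exprn_gt0//.
have -> : 2 * eta * S * (1 - mu) ^+ 2 = 2 * eta * ((1 - mu) ^+ 2 * S) by ring.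
apply: (@le_trans _ _ (2 * eta * V)).
  by rewrite ler_wpM2l// mulr_ge0// ltW.
by rewrite sum_energy_drop gerBl ltW// energy_gt0.
Qed.

(** The share of one coordinate in the first- and second-order terms of the
    descent of [F], summed over time: [v - delta] stands for the partial derivative
    of [F] and [- (2 eta r_(t+1) m_(t+1))] for the displacement.  The noise enters
    only through Young's inequality with weights [lam] and [kap], which leaves
    room for [lam = kap = 0] when there is none. *)
Lemma coordinate_descent (delta : nat -> R) (lam kap K : R) (T : nat) :
  0 <= kap -> 0 <= K ->
  (forall t x, 2 * delta t * x <= lam * delta t ^+ 2 + kap * x ^+ 2) ->
  \sum_(t < T) ((v t - delta t) * (- (2 * eta * r t.+1 * m t.+1)) +
     K * (- (2 * eta * r t.+1 * m t.+1)) ^+ 2) <=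
  r T - r 0%N + mu / 2 * (1 + 1 / (1 - mu) ^+ 2) * r 0%N +
  eta * lam * \sum_(t < T) delta t ^+ 2 +
  (kap + 4 * eta * K) * r 0%N ^+ 2 / (2 * (1 - mu) ^+ 2).
Proof.
move=> kap0 K0 young.
have e0 := ltW eta_gt0.
have r0 t : 0 <= r t by rewrite ltW// energy_gt0.
pose V := \sum_(t < T) (r t.+1 * v t ^+ 2).
pose M := \sum_(t < T) (r t.+1 * m t ^+ 2).
pose M' := \sum_(t < T) (r t.+1 * m t.+1 ^+ 2).
apply: (@le_trans _ _ (- (2 * eta * V) + eta * mu * V + eta * mu * M +
  eta * lam * (\sum_(t < T) delta t ^+ 2) +
  (eta * kap + 4 * eta ^+ 2 * K) * r 0%N * M')).
  rewrite /V /M /M' !mulr_sumr -sumrN -!big_split/=; apply: ler_sum => t _.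
  set q := r t.+1; set p := m t.+1; have q0 : 0 <= q := r0 t.+1.
  have h1 : 2 * delta t * (q * p) <= lam * delta t ^+ 2 + kap * (q * p) ^+ 2.
    exact: young.
  have h2 : (q * p) ^+ 2 <= r 0%N * (q * p ^+ 2).
    rewrite exprMn expr2 -mulrA ler_wpM2r ?energy_nonincreasing//.
    nonneg.
  have h3 : - (2 * v t * m t) <= v t ^+ 2 + m t ^+ 2.
    by have := sqr_ge0 (v t + m t); lra.
  have h1' : eta * (2 * delta t * (q * p)) <=
      eta * (lam * delta t ^+ 2 + kap * (q * p) ^+ 2) by rewrite ler_wpM2l.
  have h2' : (eta * kap + 4 * eta ^+ 2 * K) * (q * p) ^+ 2 <=
     (eta * kap + 4 * eta ^+ 2 * K) * (r 0%N * (q * p ^+ 2)).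
    rewrite ler_wpM2l//; nonneg.
  have h3' : eta * mu * q * - (2 * v t * m t) <=
      eta * mu * q * (v t ^+ 2 + m t ^+ 2).
    rewrite ler_wpM2l//; nonneg.
  have pE : v t * p = mu * (v t * m t) + v t ^+ 2 by rewrite /p mS; ring.
  have pE' : eta * q * (v t * p) = eta * q * (mu * (v t * m t) + v t ^+ 2).
    by rewrite pE.
  (* With the products generalized, the claim is a linear combination. *)
  clearbody p q; move: h1' h2' h3' pE'; clear.
  by move: (v t) (m t) (delta t) (r 0%N) => v' m' delta' r'; lra.
have hV : 2 * eta * V = r 0%N - r T by exact: sum_energy_drop.
have hM' : 2 * eta * M' <= r 0%N / (1 - mu) ^+ 2 by exact: sum_momentum_le.
have hM : 2 * eta * M <= r 0%N / (1 - mu) ^+ 2.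
  apply: le_trans hM'; rewrite ler_wpM2l ?mulr_ge0//.
  by apply: le_trans (sum_momentum_shift T); rewrite lerDl mulr_ge0 ?sqr_ge0.
have a1 : mu / 2 * (2 * eta * V) <= mu / 2 * r 0%N.
  rewrite ler_wpM2l ?hV ?gerBl//; nonneg.
have a2 : mu / 2 * (2 * eta * M) <= mu / 2 * (r 0%N / (1 - mu) ^+ 2).
  rewrite ler_wpM2l//; nonneg.
have a3 : (kap + 4 * eta * K) * r 0%N / 2 * (2 * eta * M') <=
   (kap + 4 * eta * K) * r 0%N / 2 * (r 0%N / (1 - mu) ^+ 2).
  rewrite ler_wpM2l//; nonneg.
have -> : mu / 2 * (1 + 1 / (1 - mu) ^+ 2) * r 0%N =
  mu / 2 * r 0%N + mu / 2 * (r 0%N / (1 - mu) ^+ 2) by ring.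
have -> : (kap + 4 * eta * K) * r 0%N ^+ 2 / (2 * (1 - mu) ^+ 2) =
  (kap + 4 * eta * K) * r 0%N / 2 * (r 0%N / (1 - mu) ^+ 2).
  by rewrite invfM; ring.
lra.
Qed.

End CoordinateEnergy.

(** * Descent of the square root of the objective *)

Lemma sqrtr_tangent {R : realType} (a b : R) : 0 < a -> 0 <= b ->
  Num.sqrt b <= Num.sqrt a + (b - a) / (2 * Num.sqrt a).
Proof.
move=> a0 b0; have s0 : 0 < Num.sqrt a by rewrite sqrtr_gt0.
have sa := sqr_sqrtr (ltW a0); have sb := sqr_sqrtr b0.
rewrite -lerBlDl ler_pdivlMr ?mulr_gt0// -[X in _ <= X - _]sb -[X in _ <= _ - X]sa.
by have := sqr_ge0 (Num.sqrt b - Num.sqrt a); lra.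
Qed.

Lemma enormE {R : realType} (n : nat) (x : 'rV[R]_n) :
  enorm x ^+ 2 = \sum_(i < n) x 0 i ^+ 2.
Proof. by rewrite sqr_sqrtr// sumr_ge0// => i _; exact: sqr_ge0. Qed.

(** Steps [e] and [-e] from the minimizer: adding the two smoothness inequalities
    cancels the gradient and leaves [0 <= L]. *)
Lemma L_smooth_minimizer_ge0 {R : realType} (n : nat) (L : R)
    (g : 'rV[R]_n -> R) (xs : 'rV[R]_n) :
  (0 < n)%N -> L_smooth L g -> (forall x, g xs <= g x) -> 0 <= L.
Proof.
move=> n0 gL gmin; pose e : 'rV[R]_n := delta_mx 0 (Ordinal n0).
have e1 : enorm e ^+ 2 = 1.
  rewrite enormE (bigD1 (Ordinal n0))//= big1 => [|i ni].
    by rewrite mxE !eqxx expr1n addr0.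
  by rewrite mxE (negPf ni) andbF expr0n.
have := gL xs (xs + e); have := gL xs (xs - e).
rewrite !(addrC xs) !addrK.
have -> : enorm (- e) = enorm e.
  by congr Num.sqrt; apply: eq_bigr => i _; rewrite [(- e) 0 i]mxE sqrrN.
have -> : dotv (grad g xs) (- e) = - dotv (grad g xs) e.
  by rewrite /dotv -sumrN; apply: eq_bigr => i _; rewrite [(- e) 0 i]mxE mulrN.
rewrite e1; have := gmin (e + xs); have := gmin (- e + xs).
lra.
Qed.

(** Concavity bounds the increase of the square root by its tangent at [x], so the
    smoothness inequality is divided by [2 F x]; the curvature then becomes uniform
    because [0 <= L] and [F xs <= F x]. *)
Lemma sqrt_objective_descent {R : realType} (n : nat) (L c : R)
    (g : 'rV[R]_n -> R) (xs x y : 'rV[R]_n) :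
  (0 < n)%N -> L_smooth L g -> (forall z, g xs <= g z) -> 0 < g xs + c ->
  Num.sqrt (g y + c) <= Num.sqrt (g x + c) +
    \sum_(i < n) (partial g i x / (2 * Num.sqrt (g x + c)) * (y - x) 0 i +
      L / (4 * Num.sqrt (g xs + c)) * (y - x) 0 i ^+ 2).
Proof.
move=> n0 gL gmin gs0.
have L0 := L_smooth_minimizer_ge0 n0 gL gmin.
have gp z : 0 < g z + c by apply: lt_le_trans gs0 _; rewrite lerD2r.
have s0 z : 0 < Num.sqrt (g z + c) by rewrite sqrtr_gt0.
apply: le_trans (sqrtr_tangent (gp x) (ltW (gp y))) _.
rewrite lerD2l big_split/= -mulr_sumr -enormE.
set E := enorm _ ^+ 2; set s := Num.sqrt (g x + c); have hs : 0 < s := s0 x.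
have -> : \sum_(i < n) partial g i x / (2 * s) * (y - x) 0 i =
    dotv (grad g x) (y - x) / (2 * s).
  by rewrite /dotv mulr_suml; apply: eq_bigr => i _; rewrite !mxE; ring.
have gLxy : g y + c - (g x + c) <= dotv (grad g x) (y - x) + L / 2 * E.
  by have := gL x y; rewrite -/E; lra.
apply: (@le_trans _ _ ((dotv (grad g x) (y - x) + L / 2 * E) / (2 * s))).
  by rewrite ler_pM2r// invr_gt0 mulr_gt0.
rewrite mulrDl lerD2l.
have -> : L / 2 * E / (2 * s) = L * E / 4 / s by field; rewrite gt_eqF.
have -> : L / (4 * Num.sqrt (g xs + c)) * E = L * E / 4 / Num.sqrt (g xs + c).
  by field; rewrite gt_eqF.
rewrite ler_wpM2l//; first (rewrite /E; nonneg).
by rewrite lef_pV2 ?posrE// ler_sqrt ?lerD2r// ltW.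
Qed.

(** The bound from below on every energy, along an arbitrary sequence of samples:
    [g] is the objective whose gradient the samples estimate and [delta] is the
    estimation error on the gradient of its square root. *)
Lemma AEGDM_descent {R : realType} (n : nat) (Xi : Type)
    (f : 'rV[R]_n -> Xi -> R) (c eta mu : R) (theta0 : 'rV[R]_n)
    (x : nat -> Xi) (theta r v m : nat -> 'rV[R]_n)
    (g : 'rV[R]_n -> R) (L : R) (xs : 'rV[R]_n) (lam kap : R) :
  (0 < n)%N -> (forall y z, 0 < f y z + c) ->
  0 < eta -> 0 <= mu -> mu < 1 ->
  AEGDM f c eta mu theta0 x theta r v m ->
  L_smooth L g -> (forall z, g xs <= g z) -> 0 < g xs + c ->
  let delta t i :=
    v t 0 i - partial g i (theta t) / (2 * Num.sqrt (g (theta t) + c)) in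
  0 <= kap ->
  (forall t i y, 2 * delta t i * y <= lam * delta t i ^+ 2 + kap * y ^+ 2) ->
  forall T i,
  Num.sqrt (g xs + c) <= r T 0 i +
    (Num.sqrt (g theta0 + c) - Num.sqrt (f theta0 (x 0%N) + c)) +
    n%:R * (mu / 2 * (1 + 1 / (1 - mu) ^+ 2) * Num.sqrt (f theta0 (x 0%N) + c)
     + (kap + L * eta / Num.sqrt (g xs + c)) * (f theta0 (x 0%N) + c) /
       (2 * (1 - mu) ^+ 2)) +
    eta * lam * \sum_(i < n) \sum_(t < T) delta t i ^+ 2.
Proof.
move=> n0 fpos eta0 mu0 mu1 run gL gmin gs0 delta kap0 young T i0.
set r0 := Num.sqrt (f theta0 (x 0%N) + c).
set Fs := Num.sqrt (g xs + c).
have L0 := L_smooth_minimizer_ge0 n0 gL gmin.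
have Fs0 : 0 < Fs by rewrite sqrtr_gt0.
have r00 : 0 < r0 by rewrite sqrtr_gt0.
have r0E i : r 0%N 0 i = r0 by exact: (AEGDM_r0 run).
have ri0 i : 0 < r 0%N 0 i by rewrite r0E.
pose K := L / (4 * Fs).
have K0 : 0 <= K by rewrite divr_ge0// mulr_ge0// ltW.
pose F t := Num.sqrt (g (theta t) + c).
pose s t i := (v t 0 i - delta t i) * - (2 * eta * r t.+1 0 i * m t.+1 0 i) +
  K * (- (2 * eta * r t.+1 0 i * m t.+1 0 i)) ^+ 2.
have step t : F t.+1 <= F t + \sum_(i < n) s t i.
  apply: le_trans (sqrt_objective_descent (theta t) (theta t.+1) n0 gL gmin gs0) _.
  rewrite lerD2l; apply: ler_sum => i _.
  have -> : (theta t.+1 - theta t) 0 i = - (2 * eta * r t.+1 0 i * m t.+1 0 i).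
    by rewrite !mxE (AEGDM_theta run); ring.
  by rewrite /s /delta subKr.
have FT : F T <= F 0%N + \sum_(i < n) \sum_(t < T) s t i.
  rewrite exchange_big/=; elim: T => [|k IH]; first by rewrite big_ord0 addr0.
  rewrite big_ord_recr/= addrA.
  by apply: le_trans (step k) _; rewrite lerD2r.
have cd i := @coordinate_descent R eta mu (fun t => r t 0 i) (fun t => v t 0 i)
  (fun t => m t 0 i) eta0 mu0 mu1 (ri0 i) (AEGDM_m0 run i)
  (fun t => AEGDM_m run t i) (fun t => AEGDM_r run t i) (delta^~ i)
  lam kap K T kap0 K0 (fun t => young t i).
pose A := mu / 2 * (1 + 1 / (1 - mu) ^+ 2) * r0 +
  (kap + 4 * eta * K) * r0 ^+ 2 / (2 * (1 - mu) ^+ 2).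
have sumle : \sum_(i < n) \sum_(t < T) s t i <= (r T 0 i0 - r0) +
    n%:R * A + eta * lam * \sum_(i < n) \sum_(t < T) delta t i ^+ 2.
  apply: (@le_trans _ _ (\sum_(i < n) ((r T 0 i - r0) + A +
      eta * lam * \sum_(t < T) delta t i ^+ 2))).
    apply: ler_sum => i _; apply: le_trans (cd i) _.
    by rewrite /= r0E /A; lra.
  rewrite 2!big_split/= -mulr_sumr; apply: lerD => //.
  apply: lerD; last by rewrite sumr_const card_ord mulr_natl.
  (* The energies of the other coordinates have decreased too. *)
  rewrite (bigD1 i0)//= gerDl sumr_le0// => i _.
  rewrite subr_le0 -(r0E i).
  exact: (@energy_nonincreasing R eta (fun t => r t 0 i) (fun t => v t 0 i)
    eta0 (ri0 i) (fun t => AEGDM_r run t i) 0%N T).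
have FsT : Fs <= F T by rewrite ler_sqrt ?lerD2r// ltW// (lt_le_trans gs0)// lerD2r.
have F0 : F 0%N = Num.sqrt (g theta0 + c) by rewrite /F (AEGDM_theta0 run).
have AE : A = mu / 2 * (1 + 1 / (1 - mu) ^+ 2) * r0 +
    (kap + L * eta / Fs) * (f theta0 (x 0%N) + c) / (2 * (1 - mu) ^+ 2).
  rewrite /A sqr_sqrtr ?ltW//; congr (_ + (_ + _) * _ / _).
  by rewrite /K; field; rewrite gt_eqF.
rewrite -AE -F0.
by apply: le_trans FsT _; apply: le_trans FT _; lra.
Qed.

(** * Joint measurability of functions that are continuous in one argument *)

Lemma measurable_fun_inv_ge0 d (Z : measurableType d) (R : realType)
    (h : Z -> R) : measurable_fun setT h -> (forall z, 0 <= h z) ->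
  measurable_fun setT (fun z => (h z)^-1).
Proof.
move=> mh h0; under eq_fun do rewrite -powR_inv1//.
exact: (measurableT_comp (measurable_powR _)).
Qed.

Lemma measurable_fun_sqrt d (Z : measurableType d) (R : realType)
    (h : Z -> R) : measurable_fun setT h ->
  measurable_fun setT (fun z => Num.sqrt (h z)).
Proof.
apply: measurableT_comp; apply: continuous_measurable_fun.
exact: sqrt_continuous.
Qed.

Definition grid_round (R : realType) (n k : nat) (y : 'rV[R]_n) : 'rV[int]_n :=
  \row_i Num.floor (k.+1%:R * y 0 i).

Definition grid_point (R : realType) (n k : nat) (p : 'rV[int]_n) : 'rV[R]_n :=
  \row_i ((p 0 i)%:~R / k.+1%:R).

Lemma grid_point_cvg (R : realType) (n : nat) (y : 'rV[R]_n) :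
  grid_point R k (grid_round k y) @[k --> \oo] --> y.
Proof.
apply/cvgrPdist_le => e e0.
have /cvgrPdist_le/(_ _ e0) := @cvg_harmonic R.
apply: filterS => k; rewrite sub0r normrN ger0_norm ?harmonic_ge0// => ke.
rewrite [`| _ |]mx_normrE; apply/bigmax_leP; split => [|[i j] _]; first exact: ltW.
apply: le_trans ke; rewrite (ord1 i) !mxE/=.
have k0 : 0 < k.+1%:R :> R by rewrite ltr0n.
have -> : y 0 j - (Num.floor (k.+1%:R * y 0 j))%:~R / k.+1%:R =
    (k.+1%:R * y 0 j - (Num.floor (k.+1%:R * y 0 j))%:~R) / k.+1%:R.
  by field; rewrite gt_eqF.
have k1 : 0 <= k.+1%:R^-1 :> R by rewrite invr_ge0 ltW.
rewrite normrM (ger0_norm k1) -[leRHS]/(k.+1%:R^-1) ler_piMl//.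
set u := k.+1%:R * y 0 j.
have /andP[h1 h2] := floor_itv u.
by rewrite ger0_norm ?subr_ge0// lerBlDr addrC -(intrD1 _) ltW.
Qed.

(** Rounding [Y z] to a grid of mesh [1 / k.+1] leaves countably many values, and
    on each piece where it is constant the function is measurable; continuity in
    the first argument lets the mesh tend to zero. *)
Lemma measurable_fun_caratheodory d (Z : measurableType d) (R : realType)
    (n : nat) (g : 'rV[R]_n -> Z -> R) (Y : Z -> 'rV[R]_n) :
  (forall z, continuous (g ^~ z)) ->
  (forall y, measurable_fun setT (g y)) ->
  (forall i, measurable_fun setT (fun z => Y z 0 i)) ->
  measurable_fun setT (fun z => g (Y z) z).
Proof.
move=> gc gm Ym.
apply: (@measurable_fun_cvg _ _ _ _
  (fun k z => g (grid_point R k (grid_round k (Y z))) z)); last first.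
  move=> z _; have cz : {for Y z, continuous (g ^~ z)} by exact: gc.
  exact: (continuous_cvg _ cz (@grid_point_cvg R n (Y z))).
move=> k _ A mA; rewrite setTI.
rewrite [X in measurable X](_ : _ = \bigcup_(p : 'rV[int]_n)
   ([set z | grid_round k (Y z) = p] `&` g (grid_point R k p) @^-1` A)); last first.
  apply/seteqP; split => [z Az|z [p _ [/= <-]]//].
  by exists (grid_round k (Y z)).
apply: countable_bigcupT_measurable => [|p]; first exact: countableP.
apply: measurableI; last by rewrite -[X in measurable X]setTI; exact: gm.
rewrite [X in measurable X](_ : _ = \bigcap_(i in [set: 'I_n])
   (fun z => k.+1%:R * Y z 0 i) @^-1` `[(p 0 i)%:~R, (p 0 i + 1)%:~R[); last first.
  apply/seteqP; split => [z /= <- i _|z /= pz].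
    by rewrite /= mxE in_itv/=; exact: floor_itv.
  apply/rowP => i; rewrite mxE; apply: floor_def.
  by have := pz i I; rewrite /= in_itv.
apply: fin_bigcap_measurable => // i _.
rewrite -[X in measurable X]setTI.
have : measurable_fun setT (fun z => k.+1%:R * Y z 0 i).
  by apply: measurable_funM => //; exact: Ym.
by apply => //; exact: measurable_itv.
Qed.

(** A partial derivative is the limit of the difference quotients with steps
    [1 / k.+1]. *)
Lemma measurable_fun_partial d (Z : measurableType d) (R : realType)
    (n : nat) (g : 'rV[R]_n -> Z -> R) (Y : Z -> 'rV[R]_n) (i : 'I_n) :
  (forall z y, differentiable (g ^~ z) y) ->
  (forall y, measurable_fun setT (g y)) ->
  (forall i, measurable_fun setT (fun z => Y z 0 i)) ->
  measurable_fun setT (fun z => partial (g ^~ z) i (Y z)).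
Proof.
move=> gd gm Ym.
have gc z : continuous (g ^~ z) by move=> y; exact: differentiable_continuous.
pose h k : R := k.+1%:R^-1.
apply: (@measurable_fun_cvg _ _ _ _ (fun k z =>
  (h k)^-1 * (g (h k *: delta_mx 0 i + Y z) z - g (Y z) z))).
  move=> k; apply: measurable_funM => //; apply: measurable_funB.
    apply: (measurable_fun_caratheodory (Y := fun z => _ + Y z)) => // j.
    under eq_fun do rewrite mxE.
    by apply: measurable_funD => //; exact: Ym.
  exact: measurable_fun_caratheodory.
move=> z _.
have dz : derivable (g ^~ z) (Y z) (delta_mx 0 i) by exact: diff_derivable.
have /cvgr_dnbhsP := dz.
apply; split; last exact: cvg_harmonic.
by move=> k; rewrite gt_eqF// invr_gt0.
Qed.

(** * Averaging over the next sample with the past held fixed *)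

Section PastSamples.
Context (R : realType) (d d' : measure_display) (Omega : measurableType d)
  (P : probability Omega R) (Xi : measurableType d')
  (X : nat -> {mfun Omega >-> Xi}).

(** The finite-dimensional cylinders over the samples of index less than [t].  They
    are stable under intersection and generate the sigma-algebra of the past, so
    two finite measures that agree on them agree on the whole past. *)
Definition past_cylinders (t : nat) : set (set Omega) :=
  [set C | exists2 A : nat -> set Xi, (forall s, measurable (A s)) &
    C = \bigcap_(s in [set` iota 0 t]) (X s @^-1` A s)].

Local Notation past t := (g_sigma_algebraType (past_cylinders t)).

Lemma measurable_sample s A : measurable A -> measurable (X s @^-1` A).
Proof. by move=> mA; rewrite -[X in measurable X]setTI; exact: measurable_funPT. Qed.

Lemma past_cylinders_measurable t : past_cylinders t `<=` measurable.
Proof.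
move=> _ [A mA ->]; apply: fin_bigcap_measurable => // s _.
exact: measurable_sample.
Qed.

Lemma past_cylinders_setI t : setI_closed (past_cylinders t).
Proof.
move=> _ _ [A mA ->] [B mB ->]; exists (fun s => A s `&` B s) => [s|].
  exact: measurableI.
apply/seteqP; split => [w [wA wB] s st|w wAB]; first by split; [exact: wA|exact: wB].
by split => s st; have [] := wAB s st.
Qed.

Lemma measurable_past_sample t s : (s < t)%N ->
  measurable_fun [set: past t] (X s : past t -> Xi).
Proof.
move=> st _ A mA; rewrite setTI; apply: sub_sigma_algebra.
exists (fun u => if u == s then A else setT) => [u|]; first by case: ifP.
apply/seteqP; split => [w wA u _ /=|w /(_ s)/=]; first by case: ifP => // /eqP ->.
by rewrite eqxx; apply; rewrite mem_iota.
Qed.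

Lemma measurable_to_past t :
  measurable_fun setT (idfun : Omega -> past t).
Proof.
move=> _ A mA; rewrite setTI preimage_id.
by move: A mA; apply: smallest_sub;
  [exact: sigma_algebra_measurable|exact: past_cylinders_measurable].
Qed.

Hypothesis X_indep : mutually_independent P X.

(** Both sides are finite measures in [E], and the product rule is the assumed
    independence when [E] is a cylinder. *)
Lemma past_indep t (E : set Omega) (B : set Xi) :
  <<s past_cylinders t >> E -> measurable B ->
  P (E `&` X t @^-1` B) = (P E * P (X t @^-1` B))%E.
Proof.
move=> sE mB; have mXB := measurable_sample t mB.
have p0 : 0 <= fine (P (X t @^-1` B)) by exact: fine_ge0.
pose m2 := mscale (NngNum p0) P.
have -> : P (E `&` X t @^-1` B) = mrestr P mXB E by [].
have m2E A : (P A * P (X t @^-1` B))%E = m2 A.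
  by rewrite /m2 /mscale/= fineK 1?muleC// fin_num_measure.
rewrite m2E.
apply: (@g_sigma_algebra_measure_unique _ _ _ (past_cylinders t)
   (@past_cylinders_measurable t) (fun _ => setT) _ _ (mrestr P mXB) m2) => //.
- move=> _; exists (fun _ => setT) => //.
  by apply/seteqP; split.
- by rewrite bigcup_const.
- exact: past_cylinders_setI.
- move=> _ [A mA ->]; apply: etrans (m2E _); rewrite /= /mrestr.
  rewrite (@X_indep (iota 0 t) A)// ?iota_uniq//.
  pose A' s := if s == t then B else A s.
  have := @X_indep (iota 0 t.+1) A' (iota_uniq _ _).
  have A't : A' t = B by rewrite /A' eqxx.
  rewrite -addn1 iotaD/= big_cat/= big_seq1/= A't => A'E.
  transitivity (P (\bigcap_(s in [set` iota 0 t ++ [:: t]]) X s @^-1` A' s)).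
    congr (P _); apply/seteqP; split => [w [wA wB] s /=|w wA].
      rewrite mem_cat inE /A'; have [->//|st] := eqVneq s t.
      by rewrite orbF => /wA.
    split.
      move=> s /= st; have := wA s; rewrite /= mem_cat st /= /A'.
      have [stE|_] := eqVneq s t; last exact.
      by move: st; rewrite stE mem_iota/= ltnn.
    by have := wA t; rewrite /= mem_cat inE eqxx orbT A't; apply.
  rewrite A'E; last by move=> s; rewrite /A'; case: ifP.
  congr (_ * _)%E; rewrite !big_seq; apply: eq_bigr => s.
  rewrite mem_iota /A' => /andP[_ st].
  by rewrite lt_eqF.
- by move=> _; rewrite ltey_eq fin_num_measure.
Qed.

Let to_past t : {mfun Omega >-> past t} :=
  HB.pack (idfun : Omega -> past t)
    (isMeasurableFun.Build _ _ _ _ _ (@measurable_to_past t)).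

Lemma measurable_with_past t :
  measurable_fun setT (fun w => (w, X t w) : past t * Xi).
Proof.
by apply: measurable_fun_pair; [exact: measurable_to_past|exact: measurable_funPT].
Qed.

Let with_past t : {mfun Omega >-> (past t * Xi)%type} :=
  HB.pack (fun w => (w, X t w) : past t * Xi)
    (isMeasurableFun.Build _ _ _ _ _ (@measurable_with_past t)).

(** Independence says that the two measures agree on rectangles, which determine a
    measure on the product. *)
Lemma past_sample_product t (C : set (past t * Xi)) : measurable C ->
  (distribution P (to_past t) \x distribution P (X t))%E C =
  distribution P (with_past t) C.
Proof.
apply: product_measure_unique.
move=> A B mA mB; exact: past_indep.
Qed.

(** Functions [h w x] that depend on [w] through the past only; the value [w] of
    the past is frozen while the sample [X t] is averaged over a second point
    [w']. *)
Section Freezing.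
Variables (t : nat) (h : Omega -> Xi -> \bar R).
Hypothesis h_meas : measurable_fun setT (fun z : past t * Xi => h z.1 z.2).
Hypothesis h_ge0 : forall w x, (0 <= h w x)%E.

Let h_meas1 w : measurable_fun setT (h w).
Proof. exact: (measurableT_comp h_meas (measurable_pair1 _)). Qed.

Let freeze_sample w :
  (\int[distribution P (X t)]_x h w x = \int[P]_w' h w (X t w'))%E.
Proof. exact: ge0_integral_distribution. Qed.

Lemma freezing_measurable :
  measurable_fun setT (fun w => \int[P]_w' h w (X t w'))%E.
Proof.
under eq_fun do rewrite -freeze_sample.
have F_meas := measurable_fun_fubini_tonelli_F (m2 := distribution P (X t)) _ h_meas
  (fun z => h_ge0 z.1 z.2).
exact: (measurableT_comp F_meas (@measurable_to_past t)).
Qed.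

Lemma freezing :
  (\int[P]_w h w (X t w) = \int[P]_w \int[P]_w' h w (X t w'))%E.
Proof.
under [RHS]eq_integral do rewrite -freeze_sample.
pose H z : \bar R := h z.1 z.2.
have H_ge0 z : (0 <= H z)%E by exact: h_ge0.
have F_meas := measurable_fun_fubini_tonelli_F (m2 := distribution P (X t)) _ h_meas
  (fun z => h_ge0 z.1 z.2).
have -> : (\int[P]_w h w (X t w) = \int[P]_w (H \o with_past t) w)%E by [].
rewrite -(@ge0_integral_distribution _ _ _ _ _ P (with_past t) H)//.
have -> : (\int[distribution P (with_past t)]_z H z =
    \int[distribution P (to_past t) \x distribution P (X t)]_z H z)%E.
  apply: eq_measure_integral => C mC _; exact/esym/past_sample_product.
rewrite fubini_tonelli1//.
rewrite (@ge0_integral_distribution _ _ _ _ _ P (to_past t))//.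
by move=> w; apply: integral_ge0 => x _; exact: h_ge0.
Qed.

End Freezing.
End PastSamples.

(** * Measurability of the iteration and laws of the samples *)

(** The iterates [theta t] and [m t] depend on the samples before [t] only.  The
    energy [r 0] already involves the sample of index 0, hence the restriction to
    [0 < t]; the induction step for [t = 0] recomputes it. *)
Lemma AEGDM_measurable d (Z : measurableType d) d' (Xi : measurableType d')
    (R : realType) (n : nat) (f : 'rV[R]_n -> Xi -> R) (c eta mu : R)
    (theta0 : 'rV[R]_n) (x : nat -> Z -> Xi)
    (theta r v m : nat -> Z -> 'rV[R]_n) :
  (forall z y, differentiable (f ^~ z) y) ->
  (forall y, measurable_fun setT (f y)) -> (0 < eta) ->
  (forall z, AEGDM f c eta mu theta0 (x ^~ z)
     (theta ^~ z) (r ^~ z) (v ^~ z) (m ^~ z)) ->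
  forall t, (forall s, (s < t)%N -> measurable_fun setT (x s)) ->
  forall i, [/\ measurable_fun setT (fun z => theta t z 0 i),
    measurable_fun setT (fun z => m t z 0 i) &
    (0 < t)%N -> measurable_fun setT (fun z => r t z 0 i)].
Proof.
move=> f_diff f_meas eta0 run.
have f_cont z : continuous (f ^~ z) by move=> y; exact: differentiable_continuous.
elim=> [_ i|t IH xm i].
  split => //.
    by under eq_fun do rewrite (AEGDM_theta0 (run _)); exact: measurable_cst.
  by under eq_fun do rewrite (AEGDM_m0 (run _)); exact: measurable_cst.
have {}IH j := IH (fun s st => xm s (ltnW st)) j.
have xt : measurable_fun setT (x t) by exact: xm.
have fx y : measurable_fun setT (fun z => f y (x t z)) by exact: measurableT_comp.
have thm j : measurable_fun setT (fun z => theta t z 0 j) by have [] := IH j.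
have vm : measurable_fun setT (fun z => v t z 0 i).
  under eq_fun do rewrite (AEGDM_v (run _)).
  apply: measurable_funM.
    exact: (measurable_fun_partial (g := fun y z => f y (x t z))).
  apply: measurable_fun_inv_ge0 => [|z]; last by nonneg; exact: sqrtr_ge0.
  apply: measurable_funM => //; apply: measurable_fun_sqrt.
  apply: measurable_funD => //.
  exact: (measurable_fun_caratheodory (g := fun y z => f y (x t z))).
have mm : measurable_fun setT (fun z => m t.+1 z 0 i).
  under eq_fun do rewrite (AEGDM_m (run _)).
  by apply: measurable_funD => //; apply: measurable_funM => //; have [] := IH i.
have rm0 : measurable_fun setT (fun z => r t z 0 i).
  case: (posnP t) => [t0|t0]; last by have [_ _] := IH i; exact.
  rewrite t0; under eq_fun do rewrite (AEGDM_r0 (run _)).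
  apply: measurable_fun_sqrt; apply: measurable_funD => //.
  by move: fx; rewrite t0; exact.
have rm : measurable_fun setT (fun z => r t.+1 z 0 i).
  under eq_fun do rewrite (AEGDM_r (run _)).
  apply: measurable_funM => //; apply: measurable_fun_inv_ge0 => [|z].
    apply: measurable_funD => //; apply: measurable_funM => //.
    exact: measurable_funX.
  by have e0 := ltW eta0; nonneg.
split => //.
under eq_fun do rewrite (AEGDM_theta (run _)).
apply: measurable_funB => //.
by apply: measurable_funM => //; apply: measurable_funM.
Qed.

Lemma ae_nonempty d (Omega : measurableType d) (R : realType)
  (P : probability Omega R) (Q : Omega -> Prop) :
  {ae P, forall w, Q w} -> exists w, Q w.
Proof.
move=> [N [mN PN0 QN]]; apply/not_existsP => nQ.
have NT : N = setT by apply/seteqP; split => // w _; apply: QN => /=; exact: nQ.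
by move: PN0; rewrite NT probability_setT => /eqP; rewrite onee_eq0.
Qed.

Section SampleMean.
Context (R : realType) (d d' : measure_display) (Omega : measurableType d)
  (P : probability Omega R) (Xi : measurableType d')
  (X Y : {mfun Omega >-> Xi}) (h : Xi -> R).
Hypothesis h_meas : measurable_fun setT h.
Hypothesis h_int : P.-integrable setT (EFin \o (fun w => h (X w))).
Hypothesis XY : identically_distributed P Y X.

Let integral_abs_eq :
  (\int[P]_w `|(EFin \o (h \o Y)) w| = \int[P]_w `|(EFin \o (h \o X)) w|)%E.
Proof.
have mh : measurable_fun setT (abse \o (EFin \o h)).
  by apply: measurableT_comp => //; exact/measurable_EFinP.
have h0 z : (0 <= (abse \o (EFin \o h)) z)%E by exact: abse_ge0.
have := ge0_integral_distribution (P := P) Y mh h0; rewrite /= => <-.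
have := ge0_integral_distribution (P := P) X mh h0; rewrite /= => <-.
by apply: eq_measure_integral => A mA _; exact: XY.
Qed.

Lemma integrable_same_law : P.-integrable setT (EFin \o (fun w => h (Y w))).
Proof.
apply/integrableP; split; first by apply/measurable_EFinP; exact: measurableT_comp.
have /integrableP[_] := h_int.
by congr (_ < _)%E; exact/esym/integral_abs_eq.
Qed.

Lemma integral_same_law :
  (\int[P]_w (h (Y w))%:E = \int[P]_w (h (X w))%:E)%E.
Proof.
have mh : measurable_fun setT (EFin \o h) by exact/measurable_EFinP.
have := integral_distribution (X := Y) mh integrable_same_law.
have := integral_distribution (X := X) mh h_int.
move=> /= <- <-.
by apply: eq_measure_integral => A mA _; exact: XY.
Qed.

End SampleMean.

Lemma integral_gt0 d (Omega : measurableType d) (R : realType)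
  (P : probability Omega R) (h : Omega -> R) :
  measurable_fun setT h -> (forall w, 0 < h w) ->
  (0 < \int[P]_w (h w)%:E)%E.
Proof.
move=> hm h0; rewrite lt_neqAle; apply/andP; split; last first.
  by apply: integral_ge0 => w _; rewrite lee_fin ltW.
apply/eqP => int0.
have hm' : measurable_fun setT (EFin \o h) by exact/measurable_EFinP.
have : (\int[P]_w `|(EFin \o h) w| = 0)%E.
  rewrite int0; apply: eq_integral => w _ /=; rewrite ger0_norm//.
  exact: ltW.
move=> /(ae_eq_integral_abs P measurableT hm') /ae_nonempty [w] /(_ I) /= [].
by move=> h0w; have := h0 w; rewrite h0w ltxx.
Qed.

(** * Bounds on the mean *)

Section MeanAtMost.
Context (R : realType) (d : measure_display) (Omega : measurableType d)
  (P : probability Omega R).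
Implicit Types (h g : Omega -> R) (K : R).

(** Measurability, sign and bound are kept together so that upper bounds on means
    can be added and scaled without separate integrability arguments. *)
Definition mean_at_most h K : Prop :=
  [/\ measurable_fun setT h, forall w, 0 <= h w &
      (\int[P]_w (h w)%:E <= K%:E)%E].

Lemma mean_at_most_cst K : 0 <= K -> mean_at_most (fun _ => K) K.
Proof.
by move=> K0; split => //; rewrite integral_cst//= probability_setT mule1.
Qed.

Lemma mean_at_mostD h g K K' : mean_at_most h K -> mean_at_most g K' ->
  mean_at_most (fun w => h w + g w) (K + K').
Proof.
move=> [hm h0 hK] [gm g0 gK]; split => [|w|]; first exact: measurable_funD.
  by rewrite addr_ge0.
under eq_integral do rewrite EFinD.
rewrite ge0_integralD//; [|by move=> w _; rewrite lee_fin|exact/measurable_EFinP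
  |by move=> w _; rewrite lee_fin|exact/measurable_EFinP].
by rewrite EFinD leeD.
Qed.

Lemma mean_at_mostZ (k : R) h K : 0 <= k -> mean_at_most h K ->
  mean_at_most (fun w => k * h w) (k * K).
Proof.
move=> k0 [hm h0 hK]; split => [|w|]; first exact: measurable_funM.
  exact: mulr_ge0.
under eq_integral do rewrite EFinM.
rewrite ge0_integralZl//; [|exact/measurable_EFinP|by move=> w _; rewrite lee_fin].
by rewrite EFinM lee_wpmul2l// lee_fin.
Qed.

Lemma mean_at_most_sum (T : nat) (h : nat -> Omega -> R) (K : R) :
  (forall t, mean_at_most (h t) K) ->
  mean_at_most (fun w => \sum_(t < T) h t w) (T%:R * K).
Proof.
move=> hK; elim: T => [|T IH].
  under eq_fun do rewrite big_ord0.
  by rewrite mul0r; exact: mean_at_most_cst.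
under eq_fun do rewrite big_ord_recr.
by rewrite -natr1 mulrDl mul1r; exact: mean_at_mostD.
Qed.

Lemma le_mean_at_most (F : R) (r h : Omega -> R) K :
  0 <= F -> measurable_fun setT r -> (forall w, 0 <= r w) ->
  mean_at_most h K -> {ae P, forall w, F <= r w + h w} ->
  ((F - K)%:E <= \int[P]_w (r w)%:E)%E.
Proof.
move=> F0 rm r0 [hm h0 hK] Frh.
have : (\int[P]_w F%:E <= \int[P]_w ((r w)%:E + (h w)%:E))%E.
  apply: ae_ge0_le_integral => //.
  - by move=> w _; rewrite -EFinD lee_fin addr_ge0.
  - by apply/measurable_EFinP; exact: measurable_funD.
  - by apply: filterS Frh => w Fw _; rewrite -EFinD lee_fin.
rewrite integral_cst//= probability_setT mule1.
rewrite ge0_integralD//; [|by move=> w _; rewrite lee_fin|exact/measurable_EFinP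
  |by move=> w _; rewrite lee_fin|exact/measurable_EFinP].
move=> FK; rewrite EFinB leeBlDr//.
by apply: le_trans FK _; rewrite leeD2l.
Qed.

End MeanAtMost.

Lemma freezing_mean_at_most (R : realType) (d d' : measure_display)
    (Omega : measurableType d) (P : probability Omega R)
    (Xi : measurableType d') (X : nat -> {mfun Omega >-> Xi}) (t : nat)
    (h : Omega -> Xi -> R) (K : R) :
  mutually_independent P X ->
  measurable_fun setT
    (fun z : g_sigma_algebraType (past_cylinders X t) * Xi => h z.1 z.2) ->
  (forall w x, 0 <= h w x) -> 0 <= K ->
  {ae P, forall w, (\int[P]_w' (h w (X t w'))%:E <= K%:E)%E} ->
  mean_at_most P (fun w => h w (X t w)) K.
Proof.
move=> ind hm h0 K0 hK; split => //.
  exact: (measurableT_comp hm (@measurable_with_past _ _ _ _ X t)).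
have hm' : measurable_fun setT
    (fun z : g_sigma_algebraType (past_cylinders X t) * Xi => (h z.1 z.2)%:E).
  exact/measurable_EFinP.
rewrite (@freezing _ _ _ _ P _ X ind t (fun w x => (h w x)%:E) hm')//.
have -> : K%:E = (\int[P]_w (cst K%:E w))%E.
  by rewrite integral_cst//= probability_setT mule1.
apply: ae_ge0_le_integral => //.
- by move=> w _; apply: integral_ge0 => x _; rewrite lee_fin.
- exact: (@freezing_measurable _ _ _ _ P _ X t (fun w x => (h w x)%:E) hm').
- by apply: filterS hK => w + _.
Qed.

(** An almost sure lower bound on [h] at the actual sample passes to the average
    over an independent copy.  The defect [g = max (a - h) 0] vanishes almost surely
    at the actual sample; by [freezing] its average over the copy vanishes for almost
    every past, and [a <= h + g]. *)
Lemma freezing_ae_ge (R : realType) (d d' : measure_display)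
    (Omega : measurableType d) (P : probability Omega R)
    (Xi : measurableType d') (X : nat -> {mfun Omega >-> Xi}) (t : nat)
    (h : Omega -> Xi -> R) (a : R) :
  mutually_independent P X ->
  measurable_fun setT
    (fun z : g_sigma_algebraType (past_cylinders X t) * Xi => h z.1 z.2) ->
  (forall w, P.-integrable setT (EFin \o (fun w' => h w (X t w')))) ->
  {ae P, forall w, a <= h w (X t w)} ->
  {ae P, forall w, (a%:E <= \int[P]_w' (h w (X t w'))%:E)%E}.
Proof.
move=> ind hm hint ha.
pose g w x := Num.max (a - h w x) 0.
have g0 w x : 0 <= g w x by rewrite le_max lexx orbT.
have gm : measurable_fun setT
    (fun z : g_sigma_algebraType (past_cylinders X t) * Xi => g z.1 z.2).
  by apply: measurable_maxr => //; exact: measurable_funB.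
have gm' : measurable_fun setT
    (fun z : g_sigma_algebraType (past_cylinders X t) * Xi => (g z.1 z.2)%:E).
  exact/measurable_EFinP.
have g0' w x : (0 <= (g w x)%:E)%E by rewrite lee_fin.
have fm := @freezing_measurable _ _ _ _ P _ X t (fun w x => (g w x)%:E) gm' g0'.
have G0 : (\int[P]_w (g w (X t w))%:E = 0)%E.
  have [N [mN PN0 Nsub]] := ha.
  rewrite (ge0_negligible_integral _ _ _ _ PN0)//; last first.
    exact: (measurableT_comp gm' (@measurable_with_past _ _ _ _ X t)).
  apply: integral0_eq => w [_ Nw].
  suff aw : a <= h w (X t w) by rewrite /g max_r// subr_le0.
  by apply: contrapT => naw; apply: Nw; exact: Nsub.
have := @freezing _ _ _ _ P _ X ind t (fun w x => (g w x)%:E) gm' g0'.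
rewrite G0 => /esym GG0.
have : (\int[P]_w `|\int[P]_w' (g w (X t w'))%:E| = 0)%E.
  rewrite -[RHS]GG0; apply: eq_integral => w _; rewrite gee0_abs//.
  by apply: integral_ge0 => x _.
move=> /(ae_eq_integral_abs P measurableT fm).
apply: filterS => w /(_ I) /= gw0.
have gwm : measurable_fun setT (fun w' => g w (X t w')).
  apply: measurable_maxr => //; apply: measurable_funB => //.
  by have /integrableP[/measurable_EFinP] := hint w.
have gwint : P.-integrable setT (EFin \o (fun w' => g w (X t w'))).
  apply/integrableP; split; first exact/measurable_EFinP.
  rewrite (eq_integral (fun w' => (g w (X t w'))%:E)) ?gw0//.
  by move=> w' _ /=; rewrite ger0_norm.
rewrite -[leRHS]adde0 -gw0 -(integralD _ (hint w) gwint)//.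
rewrite -[a%:E]mule1 -(probability_setT P) -(integral_cst P measurableT a%:E).
apply: le_integral => //.
- exact: finite_measure_integrable_cst.
- exact: integrableD.
- move=> w' _ /=; rewrite -EFinD lee_fin /g -lerBlDl.
  by rewrite le_max lexx.
Qed.

(** * Noise on the gradient of the square root, and the constants *)

(** The difference of the square roots is [x - y] divided by their sum, which is at
    least [2 sqrt a]. *)
Lemma sqr_sqrtr_diff_le (R : realType) (a x y : R) :
  0 < a -> a <= x -> a <= y ->
  (Num.sqrt x - Num.sqrt y) ^+ 2 <= (x - y) ^+ 2 / (4 * a).
Proof.
move=> a0 ax ay.
have sx := sqr_sqrtr (le_trans (ltW a0) ax).
have sy := sqr_sqrtr (le_trans (ltW a0) ay).
have sx0 := sqrtr_ge0 x; have sy0 := sqrtr_ge0 y.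
rewrite ler_pdivlMr ?mulr_gt0// -[in leRHS]sx -[in leRHS]sy subr_sqr exprMn.
rewrite ler_wpM2l ?sqr_ge0//.
have xy : a <= Num.sqrt x * Num.sqrt y.
  rewrite -sqrtrM ?(le_trans (ltW a0))// -[leLHS](ger0_norm (ltW a0)) -sqrtr_sqr.
  by rewrite ler_sqrt ?expr2 ?mulr_ge0 ?ler_pM ?(le_trans (ltW a0))// ltW.
by rewrite sqrrD sx sy; lra.
Qed.

(** Young's inequality for [|x - y| / (2 sqrt a)].  The weight [s] makes the mean
    of the right side equal to [s / (2 sqrt a)], the first term of [D3_const], when the
    mean of [(x - y)^2] is [s^2]. *)
Lemma sqrtr_diff_le (R : realType) (a s x y : R) :
  0 < a -> 0 < s -> a <= x -> a <= y ->
  `|Num.sqrt x - Num.sqrt y| <=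
    (4 * s * Num.sqrt a)^-1 * (x - y) ^+ 2 + s / (4 * Num.sqrt a).
Proof.
move=> a0 s0 ax ay.
have sa0 : 0 < Num.sqrt a by rewrite sqrtr_gt0.
have sa := sqr_sqrtr (ltW a0).
set u := `| _ |.
have u2 : u ^+ 2 <= (x - y) ^+ 2 / (4 * a).
  by rewrite real_normK ?num_real//; exact: sqr_sqrtr_diff_le.
have -> : (4 * s * Num.sqrt a)^-1 * (x - y) ^+ 2 + s / (4 * Num.sqrt a) =
  Num.sqrt a / s * ((x - y) ^+ 2 / (4 * a)) + s / (4 * Num.sqrt a).
  by move: sa0 sa; set b := Num.sqrt a => b0 <-; field; rewrite !gt_eqF.
apply: (@le_trans _ _ (Num.sqrt a / s * u ^+ 2 + s / (4 * Num.sqrt a))).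
  rewrite -subr_ge0.
  have -> : Num.sqrt a / s * u ^+ 2 + s / (4 * Num.sqrt a) - u =
    Num.sqrt a / s * (u - s / (2 * Num.sqrt a)) ^+ 2.
    by field; rewrite !gt_eqF.
  by rewrite mulr_ge0 ?sqr_ge0// divr_ge0// ltW.
by rewrite lerD2r ler_wpM2l// divr_ge0// ltW.
Qed.

(** With [q^2] for the mean of [x], this bounds the mean of [sqrt x] by [q]. *)
Lemma sqrtr_young (R : realType) (q x : R) : 0 < q -> 0 <= x ->
  Num.sqrt x <= (2 * q)^-1 * x + q / 2.
Proof.
move=> q0 x0; rewrite -[x in leRHS](sqr_sqrtr x0) -subr_ge0.
set u := Num.sqrt x.
have -> : (2 * q)^-1 * u ^+ 2 + q / 2 - u = (2 * q)^-1 * (u - q) ^+ 2.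
  by field; rewrite gt_eqF.
by rewrite mulr_ge0 ?sqr_ge0// invr_ge0 mulr_ge0// ltW.
Qed.

(** The error is the sum of [(g - h) / (2 sqrt y)], due to the gradient, and of
    [g / 2 (1 / sqrt x - 1 / sqrt y)], due to the value; the square of the second
    factor is at most [(x - y)^2 / (4 a^3)]. *)
Lemma gradient_noise_le (R : realType) (n : nat) (g h : 'rV[R]_n) (a x y G : R) :
  0 < a -> a <= x -> a <= y -> enorm g <= G ->
  \sum_(i < n) (g 0 i / (2 * Num.sqrt x) - h 0 i / (2 * Num.sqrt y)) ^+ 2 <=
  (2 * a)^-1 * enorm (g - h) ^+ 2 + G ^+ 2 / (8 * a ^+ 3) * (x - y) ^+ 2.
Proof.
move=> a0 ax ay gG.
have x0 : 0 < x by exact: lt_le_trans ax.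
have y0 : 0 < y by exact: lt_le_trans ay.
have sx0 : 0 < Num.sqrt x by rewrite sqrtr_gt0.
have sy0 : 0 < Num.sqrt y by rewrite sqrtr_gt0.
have sx := sqr_sqrtr (ltW x0); have sy := sqr_sqrtr (ltW y0).
set D := ((Num.sqrt x)^-1 - (Num.sqrt y)^-1) ^+ 2.
have Dle : D <= (x - y) ^+ 2 / (4 * a ^+ 3).
  have -> : D = (Num.sqrt x - Num.sqrt y) ^+ 2 * (x * y)^-1.
    rewrite /D; move: sx0 sx sy0 sy.
    set b := Num.sqrt x => b0 <-; set e := Num.sqrt y => e0 <-.
    by field; rewrite !gt_eqF.
  have -> : (x - y) ^+ 2 / (4 * a ^+ 3) = (x - y) ^+ 2 / (4 * a) * (a * a)^-1.
    by field; rewrite gt_eqF.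
  apply: ler_pM; [exact: sqr_ge0| |exact: sqr_sqrtr_diff_le|].
    by rewrite invr_ge0 ltW// mulr_gt0.
  rewrite lef_pV2 ?posrE ?mulr_gt0//.
  by have a0' := ltW a0; exact: ler_pM.
have g2 : \sum_(i < n) g 0 i ^+ 2 <= G ^+ 2.
  by rewrite -enormE ler_pXn2r ?nnegrE ?sqrtr_ge0// (le_trans _ gG) ?sqrtr_ge0.
apply: (@le_trans _ _ (\sum_(i < n)
   ((2 * a)^-1 * (g 0 i - h 0 i) ^+ 2 + D / 2 * g 0 i ^+ 2))).
  apply: ler_sum => i _.
  have -> : g 0 i / (2 * Num.sqrt x) - h 0 i / (2 * Num.sqrt y) =
    (g 0 i - h 0 i) / (2 * Num.sqrt y) +
    g 0 i / 2 * ((Num.sqrt x)^-1 - (Num.sqrt y)^-1).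
    by field; rewrite !gt_eqF.
  set p := (g 0 i - h 0 i) / _; set e := g 0 i / 2 * _.
  have -> : D / 2 * g 0 i ^+ 2 = 2 * e ^+ 2 by rewrite /e /D; field; rewrite !gt_eqF.
  have p2 : 2 * p ^+ 2 <= (2 * a)^-1 * (g 0 i - h 0 i) ^+ 2.
    have -> : 2 * p ^+ 2 = (2 * y)^-1 * (g 0 i - h 0 i) ^+ 2.
      rewrite /p; move: sy0 sy; set b := Num.sqrt y => b0 <-.
      by field; rewrite gt_eqF.
    rewrite ler_wpM2r ?sqr_ge0// lef_pV2 ?posrE ?mulr_gt0//.
    by rewrite ler_wpM2l.
  by have := sqr_ge0 (p - e); lra.
rewrite big_split/= -!mulr_sumr enormE; apply: lerD.
  by under [in leRHS]eq_bigr do rewrite !mxE.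
apply: (@le_trans _ _ (D / 2 * G ^+ 2)).
  by rewrite ler_wpM2l// divr_ge0// sqr_ge0.
have -> : G ^+ 2 / (8 * a ^+ 3) * (x - y) ^+ 2 =
  (x - y) ^+ 2 / (4 * a ^+ 3) / 2 * G ^+ 2 by field; rewrite gt_eqF.
by rewrite ler_wpM2r ?sqr_ge0// ler_pM2r.
Qed.

Lemma curvature_le_D1 (R : realType) (n : nat) (eta mu G q Fs L : R) :
  0 < eta -> mu < 1 -> 0 < q -> 0 < Fs ->
  n%:R * (L * eta / Fs / (2 * (1 - mu) ^+ 2)) * q ^+ 2 <=
  eta * D1_const n mu (LF_const L G (Fs ^+ 2)) (q ^+ 2).
Proof.
move=> eta0 mu1 q0 Fs0; rewrite /D1_const /LF_const sqrtr_sqr (gtr0_norm Fs0).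
have m0 : 0 < 1 - mu by rewrite subr_gt0.
have -> : n%:R * (L * eta / Fs / (2 * (1 - mu) ^+ 2)) * q ^+ 2 =
  eta * (1 / (2 * Fs) * L * n%:R * q ^+ 2 / (1 - mu) ^+ 2).
  by field; rewrite !gt_eqF.
rewrite ler_pM2l// ler_pM2r ?invr_gt0 ?exprn_gt0// ler_pM2r ?exprn_gt0//.
rewrite ler_wpM2r// ler_pM2l ?divr_gt0 ?mulr_gt0// lerDl.
by rewrite divr_ge0 ?sqr_ge0// mulr_ge0 ?sqr_ge0.
Qed.

Lemma momentum_eq_D2 (R : realType) (n : nat) (mu q : R) : 0 < q ->
  n%:R * (mu / 2 * (1 + 1 / (1 - mu) ^+ 2)) * q = mu * D2_const n mu (q ^+ 2).
Proof. by move=> q0; rewrite /D2_const sqrtr_sqr (gtr0_norm q0); ring. Qed.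

(** The terms of the integrated bound add up to the constants of the theorem once
    the noise weight [lam] balances the two terms in which it occurs; their sum is
    then twice their geometric mean, the second term of [D3_const].  The numbers
    [q] and [Fs] are [sqrt (fbar theta0 + c)] and [sqrt (fbar thetas + c)]. *)
Lemma balanced_constants (R : realType) (n T : nat) (eta mu a G s q Fs L : R) :
  (0 < n)%N -> (0 < T)%N -> 0 < eta -> mu < 1 -> 0 < a ->
  0 < s -> 0 < q -> 0 < Fs -> 0 <= L ->
  exists2 lam : R, 0 < lam &
  n%:R * (mu / 2 * (1 + 1 / (1 - mu) ^+ 2) * (2 * q)^-1 +
      (lam^-1 + L * eta / Fs) / (2 * (1 - mu) ^+ 2)) * q ^+ 2 +
  (T%:R * (eta * lam * (2 * a)^-1 * s ^+ 2 +
           eta * lam * (G ^+ 2 / (8 * a ^+ 3)) * s ^+ 2) +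
   ((4 * s * Num.sqrt a)^-1 * s ^+ 2 +
    (n%:R * (mu / 2 * (1 + 1 / (1 - mu) ^+ 2) * (q / 2)) +
     s / (4 * Num.sqrt a)))) <=
  eta * D1_const n mu (LF_const L G (Fs ^+ 2)) (q ^+ 2) +
  mu * D2_const n mu (q ^+ 2) + s * D3_const n T eta mu a G (q ^+ 2).
Proof.
move=> n0 T0 eta0 mu1 a0 s0 q0 Fs0 L0.
have m0 : 0 < 1 - mu by rewrite subr_gt0.
have nR : 0 < n%:R :> R by rewrite ltr0n.
have TR : 0 < T%:R :> R by rewrite ltr0n.
have sa0 : 0 < Num.sqrt a by rewrite sqrtr_gt0.
pose C := G ^+ 2 / (4 * a ^+ 3) + 1 / a.
have C0 : 0 < C.
  by rewrite ltr_wpDl ?divr_gt0// divr_ge0 ?sqr_ge0// mulr_ge0// exprn_ge0// ltW.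
have k0 : 0 < Num.sqrt C by rewrite sqrtr_gt0.
have k2 := sqr_sqrtr (ltW C0).
have u0 : 0 < Num.sqrt (eta * n%:R * T%:R) by rewrite sqrtr_gt0 !mulr_gt0.
have u2 : Num.sqrt (eta * n%:R * T%:R) ^+ 2 = eta * n%:R * T%:R.
  by rewrite sqr_sqrtr// !mulr_ge0// ltW.
set k := Num.sqrt C in k0 k2; set u := Num.sqrt _ in u0 u2.
(* The sum is [lam * x + y / lam] with [lam * x] equal to [y / lam] here. *)
pose lam := n%:R * q / (s * k * u * (1 - mu)).
exists lam; first by rewrite divr_gt0 ?mulr_gt0.
rewrite /D3_const -/C -/k -/u.
have -> : Num.sqrt (q ^+ 2) = q by rewrite sqrtr_sqr gtr0_norm.
pose W := s * (k * (q / (1 - mu)) * u).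
have E1 : T%:R * (eta * lam * (2 * a)^-1 * s ^+ 2 +
    eta * lam * (G ^+ 2 / (8 * a ^+ 3)) * s ^+ 2) = W / 2.
  have -> : T%:R * (eta * lam * (2 * a)^-1 * s ^+ 2 +
    eta * lam * (G ^+ 2 / (8 * a ^+ 3)) * s ^+ 2) =
    (eta * n%:R * T%:R) * C * s * q / (2 * k * u * (1 - mu)).
    by rewrite /lam /C; field; rewrite !gt_eqF.
  by rewrite -k2 -u2 /W; field; rewrite !gt_eqF.
have E2 : n%:R * (lam^-1 / (2 * (1 - mu) ^+ 2)) * q ^+ 2 = W / 2.
  by rewrite /lam /W; field; rewrite !gt_eqF.
have E3 := curvature_le_D1 n G L eta0 mu1 q0 Fs0.
have E6 := momentum_eq_D2 n mu q0.
set M := mu / 2 * _ in E6 *.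
have E4 : n%:R * (M * (2 * q)^-1) * q ^+ 2 + n%:R * (M * (q / 2)) = n%:R * M * q.
  by field; rewrite gt_eqF.
have E5 : (4 * s * Num.sqrt a)^-1 * s ^+ 2 + s / (4 * Num.sqrt a) =
    s * (1 / (2 * Num.sqrt a)) by field; rewrite !gt_eqF.
have E7 : s * (1 / (2 * Num.sqrt a) + k * (q / (1 - mu)) * u) =
  s * (1 / (2 * Num.sqrt a)) + W by rewrite /W; ring.
rewrite E1 E7.
have -> : n%:R * (M * (2 * q)^-1 + (lam^-1 + L * eta / Fs) / (2 * (1 - mu) ^+ 2)) *
    q ^+ 2 = n%:R * (M * (2 * q)^-1) * q ^+ 2 +
    n%:R * (lam^-1 / (2 * (1 - mu) ^+ 2)) * q ^+ 2 +
    n%:R * (L * eta / Fs / (2 * (1 - mu) ^+ 2)) * q ^+ 2 by ring.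
rewrite E2; lra.
Qed.

(** * The bound in mean *)

Section Stochastic.
Context (R : realType) (d d' : measure_display) (Omega : measurableType d)
  (P : probability Omega R) (Xi : measurableType d') (n : nat)
  (xi : {mfun Omega >-> Xi}) (f : 'rV[R]_n -> Xi -> R) (c : R).
Hypothesis n_gt0 : (0 < n)%N.
Hypothesis f_diff : forall x y, differentiable (f ^~ x) y.
Hypothesis f_pos : forall y x, 0 < f y x + c.
Hypothesis f_meas : forall y, measurable_fun setT (f y).
Hypothesis f_int : forall y,
  P.-integrable setT (EFin \o (fun w => f y (xi w))).

Let fbar := mean_objective P xi f.

Lemma integral_objective y : (\int[P]_w (f y (xi w))%:E = (fbar y)%:E)%E.
Proof.
rewrite /fbar /mean_objective unlock fineK//.
exact: (integrable_fin_num measurableT (f_int y)).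
Qed.

Lemma mean_objective_gt0 y : 0 < fbar y + c.
Proof.
rewrite -lte_fin EFinD -integral_objective.
have -> : (c%:E = \int[P]_w c%:E)%E.
  by rewrite integral_cst//= probability_setT mule1.
rewrite -integralD_EFin//; last exact: finite_measure_integrable_cst.
apply: integral_gt0 => //=.
by apply: measurable_funD => //; exact: measurableT_comp.
Qed.

Context (xis : nat -> {mfun Omega >-> Xi}).
Hypothesis xis_law : forall t, identically_distributed P (xis t) xi.
Hypothesis xis_indep : mutually_independent P xis.
Hypothesis fbar_diff : forall y, differentiable fbar y.

Context (eta mu : R) (theta0 : 'rV[R]_n) (theta r v m : nat -> Omega -> 'rV[R]_n).
Hypotheses (mu_ge0 : 0 <= mu) (mu_lt1 : mu < 1) (eta_gt0 : 0 < eta).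
Hypothesis run : forall w, AEGDM f c eta mu theta0 (fun t => xis t w)
  (theta ^~ w) (r ^~ w) (v ^~ w) (m ^~ w).

Local Notation past t := (g_sigma_algebraType (past_cylinders xis t)).

(* The iteration is run on the sample space equipped with the sigma-algebra of the
   past, where the samples before [t] are still measurable. *)
Let theta_past t i : measurable_fun setT (fun z : past t * Xi => theta t z.1 0 i).
Proof.
have [+ _ _] := @AEGDM_measurable _ (past t) _ Xi R n f c eta mu theta0
  (fun s w => xis s w) theta r v m f_diff f_meas eta_gt0 run t
  (fun s st => measurable_past_sample st) i.
by move=> thm; exact: (measurableT_comp thm measurable_fst).
Qed.

Let f_joint t : measurable_fun setT (fun z : past t * Xi => f (theta t z.1) z.2).
Proof.
apply: (measurable_fun_caratheodory (g := fun y (z : past t * Xi) => f y z.2)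
  (Y := fun z => theta t z.1)) => //.
- by move=> z y; exact: differentiable_continuous.
- by move=> y; apply: measurableT_comp => //; exact: measurable_snd.
Qed.

Let fbar_joint t : measurable_fun setT (fun z : past t * Xi => fbar (theta t z.1)).
Proof.
apply: (measurable_fun_caratheodory (g := fun y (z : past t * Xi) => fbar y)
  (Y := fun z => theta t z.1)) => //.
by move=> z y; exact: differentiable_continuous.
Qed.

Let grad_joint t : measurable_fun setT (fun z : past t * Xi =>
  enorm (grad (f ^~ z.2) (theta t z.1) - grad fbar (theta t z.1)) ^+ 2).
Proof.
under eq_fun do rewrite enormE.
apply: measurable_sum => i; apply: measurable_funX.
under eq_fun do rewrite !mxE.
apply: measurable_funB.
  apply: (measurable_fun_partial (g := fun y (z : past t * Xi) => f y z.2)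
    (Y := fun z => theta t z.1)) => //.
  by move=> y; apply: measurableT_comp => //; exact: measurable_snd.
exact: (measurable_fun_partial (g := fun y (z : past t * Xi) => fbar y)
  (Y := fun z => theta t z.1)).
Qed.

Context (sigma : R).
Hypothesis sigma_gt0 : 0 < sigma.
Hypothesis grad_var : forall t, {ae P, forall w,
  (\int[P]_w' (enorm (grad (f ^~ (xis t w')) (theta t w)
                      - grad fbar (theta t w)) ^+ 2)%:E <= (sigma ^+ 2)%:E)%E}.
Hypothesis val_var : forall t, {ae P, forall w,
  (\int[P]_w' (`|f (theta t w) (xis t w') - fbar (theta t w)| ^+ 2)%:E
   <= (sigma ^+ 2)%:E)%E}.
Context (Ginf a : R).
Hypothesis a_gt0 : 0 < a.
Hypothesis grad_bound : {ae P, forall w, forall t,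
  enorm (grad (f ^~ (xis t w)) (theta t w)) <= Ginf}.
Hypothesis val_bound : {ae P, forall w, forall t,
  a <= f (theta t w) (xis t w) + c}.

Let gdev t w := enorm (grad (f ^~ (xis t w)) (theta t w)
                       - grad fbar (theta t w)) ^+ 2.
Let fdev t w := (f (theta t w) (xis t w) - fbar (theta t w)) ^+ 2.

Let gdev_mean t : mean_at_most P (gdev t) (sigma ^+ 2).
Proof.
apply: (freezing_mean_at_most xis_indep (h := fun w x =>
  enorm (grad (f ^~ x) (theta t w) - grad fbar (theta t w)) ^+ 2)) => //.
- by move=> w x; exact: sqr_ge0.
- exact: sqr_ge0.
Qed.

Let fdev_mean t : mean_at_most P (fdev t) (sigma ^+ 2).
Proof.
apply: (freezing_mean_at_most xis_indep (h := fun w x =>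
  (f (theta t w) x - fbar (theta t w)) ^+ 2)) => //.
- by apply: measurable_funX; exact: measurable_funB.
- by move=> w x; exact: sqr_ge0.
- exact: sqr_ge0.
- apply: filterS (val_var t) => w.
  by under eq_integral do rewrite real_normK ?num_real//.
Qed.

Let f0_mean : mean_at_most P (fun w => f theta0 (xis 0%N w) + c) (fbar theta0 + c).
Proof.
have f0_int := integrable_same_law (f_meas theta0) (f_int theta0) (xis_law 0%N).
split => [|w|].
- by apply: measurable_funD => //; exact: measurableT_comp.
- exact: ltW.
under eq_integral do rewrite EFinD.
rewrite integralD_EFin//; last exact: finite_measure_integrable_cst.
rewrite integral_cst//= probability_setT mule1.
rewrite (integral_same_law (f_meas theta0) (f_int theta0) (xis_law 0%N)).
by rewrite integral_objective.
Qed.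

(** The lower bound [a] is known at the samples only; averaging over an independent
    copy of [xis t] gives it for the objective. *)
Lemma mean_objective_ge t : {ae P, forall w, a <= fbar (theta t w) + c}.
Proof.
have fa : {ae P, forall w, a - c <= f (theta t w) (xis t w)}.
  by apply: filterS val_bound => w /(_ t); rewrite lerBlDr.
have := freezing_ae_ge (h := fun w x => f (theta t w) x) xis_indep (@f_joint t)
  (fun w => integrable_same_law (f_meas _) (f_int _) (xis_law t)) fa.
apply: filterS => w.
rewrite (integral_same_law (f_meas _) (f_int _) (xis_law t)).
by rewrite integral_objective lee_fin lerBlDr.
Qed.

Context (L : R) (thetas : 'rV[R]_n).
Hypothesis fbar_smooth : L_smooth L fbar.
Hypothesis thetas_min : forall y, fbar thetas <= fbar y.

(** The pathwise bound is rewritten with nonnegative terms only, each of known mean: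
    [f theta0 (xis 0) + c], the squared deviations of gradient and value, and
    constants. *)
Lemma energy_mean_ge T i : (0 < T)%N ->
  ((Num.sqrt (fbar thetas + c)
    - eta * D1_const n mu (LF_const L Ginf (fbar thetas + c)) (fbar theta0 + c)
    - mu * D2_const n mu (fbar theta0 + c)
    - sigma * D3_const n T eta mu a Ginf (fbar theta0 + c))%:E
   <= \int[P]_w (r T w 0 i)%:E)%E.
Proof.
move=> T0.
have fs0 := mean_objective_gt0 thetas; have f00 := mean_objective_gt0 theta0.
set Fs := Num.sqrt (fbar thetas + c).
set q := Num.sqrt (fbar theta0 + c).
have Fs0 : 0 < Fs by rewrite sqrtr_gt0.
have q0 : 0 < q by rewrite sqrtr_gt0.
have L0 := L_smooth_minimizer_ge0 n_gt0 fbar_smooth thetas_min.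
have Fs2 : Fs ^+ 2 = fbar thetas + c by rewrite sqr_sqrtr// ltW.
have q2 : q ^+ 2 = fbar theta0 + c by rewrite sqr_sqrtr// ltW.
have [lam lam0] := @balanced_constants R n T eta mu a Ginf sigma q Fs L
  n_gt0 T0 eta_gt0 mu_lt1 a_gt0 sigma_gt0 q0 Fs0 L0.
rewrite Fs2 q2.
set M := mu / 2 * (1 + _).
set alpha := n%:R * (_ + _); set g1 := eta * lam * (2 * a)^-1.
set g2 := eta * lam * (_ / _); set b := (_)^-1 * sigma ^+ 2.
set K := (X in X <= _ -> _) => Kle.
have m0 : 0 < 1 - mu by rewrite subr_gt0.
have sa0 : 0 < Num.sqrt a by rewrite sqrtr_gt0.
have M0 : 0 <= M.
  by rewrite /M mulr_ge0 ?divr_ge0// addr_ge0// divr_ge0// exprn_ge0// ltW.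
have alpha0 : 0 <= alpha.
  rewrite /alpha; have q0' := ltW q0; have l0' := ltW lam0.
  have Fs0' := ltW Fs0; have m0' := ltW m0; have e0' := ltW eta_gt0; nonneg.
have g10 : 0 <= g1.
  by rewrite /g1; have l0' := ltW lam0; have e0' := ltW eta_gt0;
    have a0' := ltW a_gt0; nonneg.
have g20 : 0 <= g2.
  by rewrite /g2; have l0' := ltW lam0; have e0' := ltW eta_gt0;
    have a0' := ltW a_gt0; nonneg.
pose noise w := \sum_(t < T) (g1 * gdev t w + g2 * fdev t w).
have Kmean : mean_at_most P (fun w => alpha * (f theta0 (xis 0%N w) + c) +
    (noise w + ((4 * sigma * Num.sqrt a)^-1 * fdev 0%N w +
      (n%:R * (M * (q / 2)) + sigma / (4 * Num.sqrt a))))) K.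
  apply: mean_at_mostD; first exact: mean_at_mostZ.
  apply: mean_at_mostD.
    apply: (mean_at_most_sum T
      (h := fun t w => g1 * gdev t w + g2 * fdev t w)).
    by move=> t; apply: mean_at_mostD; exact: mean_at_mostZ.
  apply: mean_at_mostD.
    by apply: mean_at_mostZ => //; rewrite invr_ge0 !mulr_ge0// ltW.
  apply: mean_at_most_cst.
  by have q0' := ltW q0; have s0' := ltW sigma_gt0; nonneg; exact: sqrtr_ge0.
have rT w : 0 <= r T w 0 i.
  apply: ltW; apply: (@energy_gt0 R eta (fun t => r t w 0 i) (fun t => v t w 0 i)).
  - exact: eta_gt0.
  - by rewrite (AEGDM_r0 (run w)) sqrtr_gt0.
  - by move=> t; exact: (AEGDM_r (run w)).
have rTm : measurable_fun setT (fun w => r T w 0 i).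
  by have [_ _] := @AEGDM_measurable _ _ _ Xi R n f c eta mu theta0
    (fun s w => xis s w) theta r v m f_diff f_meas eta_gt0 run T
    (fun s _ => measurable_funPT (xis s)) i; exact.
apply: (@le_trans _ _ (Fs - K)%:E); first by rewrite lee_fin; lra.
apply: (le_mean_at_most (ltW Fs0) rTm rT Kmean).
have /ae_foralln fbar_ge := mean_objective_ge.
move: grad_bound val_bound fbar_ge; apply: filterS3 => w gw vw fw.
pose delta t j := v t w 0 j -
  partial fbar j (theta t w) / (2 * Num.sqrt (fbar (theta t w) + c)).
have young t j y : 2 * delta t j * y <= lam * delta t j ^+ 2 + lam^-1 * y ^+ 2.
  rewrite -subr_ge0.
  have -> : lam * delta t j ^+ 2 + lam^-1 * y ^+ 2 - 2 * delta t j * y =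
    lam * (delta t j - lam^-1 * y) ^+ 2 by field; rewrite gt_eqF.
  by rewrite mulr_ge0 ?sqr_ge0// ltW.
have lam1 : 0 <= lam^-1 by rewrite invr_ge0 ltW.
have := @AEGDM_descent R n Xi f c eta mu theta0 (fun t => xis t w) (theta ^~ w)
  (r ^~ w) (v ^~ w) (m ^~ w) fbar L thetas lam lam^-1 n_gt0 f_pos eta_gt0
  mu_ge0 mu_lt1 (run w) fbar_smooth thetas_min fs0 lam1 young T i.
rewrite -/Fs -/q -/M.
set A0 := f theta0 _ + c; set r0 := Num.sqrt A0; set S := \sum_(_ < n) _ => desc.
have A00 : 0 < A0 by exact: f_pos.
have r0q : r0 <= (2 * q)^-1 * A0 + q / 2 by apply: sqrtr_young => //; exact: ltW.
have th0 : theta 0%N w = theta0 by exact: (AEGDM_theta0 (run w)).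
have q_r0 : q - r0 <= (4 * sigma * Num.sqrt a)^-1 * fdev 0%N w +
    sigma / (4 * Num.sqrt a).
  apply: le_trans (ler_norm _) _.
  have -> : fdev 0%N w = ((fbar theta0 + c) - A0) ^+ 2.
    by rewrite /fdev /A0 th0; ring.
  apply: sqrtr_diff_le => //; rewrite -?th0; first exact: fw.
  by rewrite /A0 -th0; exact: vw.
have SN : eta * lam * S <= noise w.
  rewrite /S exchange_big/= mulr_sumr; apply: ler_sum => t _.
  have -> : g1 * gdev t w + g2 * fdev t w = eta * lam *
     ((2 * a)^-1 * gdev t w + Ginf ^+ 2 / (8 * a ^+ 3) * fdev t w).
    by rewrite /g1 /g2; ring.
  rewrite ler_pM2l ?mulr_gt0//.
  have := gradient_noise_le (grad fbar (theta t w)) a_gt0 (vw t) (fw t) (gw t).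
  have -> : (f (theta t w) (xis t w) + c - (fbar (theta t w) + c)) ^+ 2 = fdev t w.
    by rewrite /fdev; ring.
  apply: le_trans; apply: ler_sum => j _.
  by rewrite /delta (AEGDM_v (run w)) !mxE.
have nM : n%:R * M * r0 <= n%:R * M * ((2 * q)^-1 * A0 + q / 2).
  by rewrite ler_wpM2l// mulr_ge0.
have alphaE : alpha * A0 = n%:R * M * ((2 * q)^-1 * A0) +
   n%:R * ((lam^-1 + L * eta / Fs) * A0 / (2 * (1 - mu) ^+ 2)).
  by rewrite /alpha; ring.
rewrite alphaE.
lra.
Qed.

End Stochastic.

(** * The noise-free case and the theorem *)

(** The pathwise bound with [delta = 0], hence with both Young weights zero; the
    curvature [L / (2 Fmin)] is at most the one in [LF_const]. *)
Lemma noise_free_energy_ge (R : realType) (n : nat) (Xi : Type)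
    (f : 'rV[R]_n -> Xi -> R) (c eta mu : R) (theta0 : 'rV[R]_n)
    (x : nat -> Xi) (theta r v m : nat -> 'rV[R]_n)
    (g : 'rV[R]_n -> R) (L G : R) (xs : 'rV[R]_n) :
  (0 < n)%N -> (forall y z, 0 < f y z + c) -> 0 < eta -> 0 <= mu -> mu < 1 ->
  AEGDM f c eta mu theta0 x theta r v m ->
  L_smooth L g -> (forall z, g xs <= g z) -> (forall y z, f y z = g y) ->
  forall T i,
  Num.sqrt (g xs + c) - eta * D1_const n mu (LF_const L G (g xs + c)) (g theta0 + c)
    - mu * D2_const n mu (g theta0 + c) <= r T 0 i.
Proof.
move=> n0 fpos eta0 mu0 mu1 run gL gmin fg T i.
have gp y : 0 < g y + c by rewrite -(fg y (x 0%N)).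
have fgz z : f ^~ z = g by apply/funext => y; exact: fg.
have q0 : 0 < Num.sqrt (g theta0 + c) by rewrite sqrtr_gt0.
have Fs0 : 0 < Num.sqrt (g xs + c) by rewrite sqrtr_gt0.
have delta0 t j : v t 0 j -
    partial g j (theta t) / (2 * Num.sqrt (g (theta t) + c)) = 0.
  by rewrite (AEGDM_v run) fgz fg subrr.
have young t j y : 2 * (v t 0 j -
    partial g j (theta t) / (2 * Num.sqrt (g (theta t) + c))) * y <=
    0 * (v t 0 j -
    partial g j (theta t) / (2 * Num.sqrt (g (theta t) + c))) ^+ 2 + 0 * y ^+ 2.
  by rewrite delta0; lra.
have := AEGDM_descent n0 fpos eta0 mu0 mu1 run gL gmin (gp xs) (lexx 0) young T i.
rewrite fg subrr addr0 add0r mulr0 mul0r addr0.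
have := curvature_le_D1 n G L eta0 mu1 q0 Fs0.
have := momentum_eq_D2 n mu q0.
set q := Num.sqrt (g theta0 + c); set Fs := Num.sqrt (g xs + c).
have -> : q ^+ 2 = g theta0 + c by rewrite sqr_sqrtr// ltW.
have -> : Fs ^+ 2 = g xs + c by rewrite sqr_sqrtr// ltW.
set M := mu / 2 * _; set D1 := eta * _; set D2 := mu * D2_const _ _ _.
have -> : n%:R * (M * q + L * eta / Fs * (g theta0 + c) / (2 * (1 - mu) ^+ 2)) =
  n%:R * M * q + n%:R * (L * eta / Fs / (2 * (1 - mu) ^+ 2)) * (g theta0 + c).
  by ring.
lra.
Qed.

Theorem theorem4p7 (R : realType) (d d' : measure_display)
    (Omega : measurableType d) (P : probability Omega R)
    (Xi : measurableType d') (n : nat) (n_gt0 : (0 < n)%N)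
    (xi : {mfun Omega >-> Xi}) (f : 'rV[R]_n -> Xi -> R) (c : R)
    (f_diff : forall x theta, differentiable (f ^~ x) theta)
    (f_pos : forall theta x, 0 < f theta x + c)
    (f_meas : forall theta, measurable_fun setT (f theta))
    (f_int : forall theta,
      P.-integrable setT (EFin \o (fun w => f theta (xi w))))
    (fbar := mean_objective P xi f)
    (fbar_diff : forall theta, differentiable fbar theta)
    (xis : nat -> {mfun Omega >-> Xi})
    (xis_law : forall t, identically_distributed P (xis t) xi)
    (eta mu : R) (mu_ge0 : 0 <= mu) (mu_lt1 : mu < 1) (eta_gt0 : 0 < eta)
    (theta0 : 'rV[R]_n) (theta r v m : nat -> Omega -> 'rV[R]_n)
    (run : forall w, AEGDM f c eta mu theta0 (fun t => xis t w)
      (theta ^~ w) (r ^~ w) (v ^~ w) (m ^~ w))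
    (L : R) (fbar_smooth : L_smooth L fbar)
    (xis_indep : mutually_independent P xis)
    (grad_unbiased : forall t, {ae P, forall w, forall i : 'I_n,
      ('E_P[fun w' => partial (f ^~ (xis t w')) i (theta t w)]
       = (partial fbar i (theta t w))%:E)%E})
    (val_unbiased : forall t, {ae P, forall w,
      ('E_P[fun w' => f (theta t w) (xis t w')] = (fbar (theta t w))%:E)%E})
    (sigma_g sigma_f : R) (sigma_g_ge0 : 0 <= sigma_g)
    (sigma_f_ge0 : 0 <= sigma_f)
    (grad_var : forall t, {ae P, forall w,
      ('E_P[fun w' => (enorm (grad (f ^~ (xis t w')) (theta t w)
                       - grad fbar (theta t w)) ^+ 2)%R]
       <= (sigma_g ^+ 2)%:E)%E})
    (val_var : forall t, {ae P, forall w,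
      ('E_P[fun w' => (`|f (theta t w) (xis t w') - fbar (theta t w)| ^+ 2)%R]
       <= (sigma_f ^+ 2)%:E)%E})
    (Ginf a B : R) (a_gt0 : 0 < a)
    (grad_bound : {ae P, forall w, forall t,
      enorm (grad (f ^~ (xis t w)) (theta t w)) <= Ginf})
    (val_bound : {ae P, forall w, forall t,
      a <= f (theta t w) (xis t w) + c <= B})
    (thetas : 'rV[R]_n) (thetas_min : forall x, fbar thetas <= fbar x)
    (sigma := Num.max sigma_f sigma_g)
    (LF := LF_const L Ginf (fbar thetas + c))
    (D1 := D1_const n mu LF (fbar theta0 + c))
    (D2 := D2_const n mu (fbar theta0 + c))
    (D3 := fun T : nat => D3_const n T eta mu a Ginf (fbar theta0 + c)) :
  (forall T : nat, (1 <= T)%N ->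
    ((Num.max (Num.sqrt (fbar thetas + c) - eta * D1 - mu * D2 - sigma * D3 T)
              0)%R%:E
     <= min_coord (fun i : 'I_n => 'E_P[fun w => (r T w 0 i)%R]))%E)
  /\
  ((forall y x, f y x = fbar y) ->
    forall w, exists rs : 'I_n -> R,
      (forall i, r t w 0 i @[t --> \oo] --> rs i) /\
      (eta * D1 + mu * D2 < Num.sqrt (fbar thetas + c) ->
        (0 < min_coord (fun i => (rs i)%:E))%E /\
        forall T : nat, (1 <= T)%N ->
          (min_coord (fun i => (rs i)%:E)
           <= min_coord (fun i => (r T w 0 i)%R%:E))%E /\
          ((exists i t, [/\ (forall j, r T w 0 i <= r T w 0 j),
                            (T <= t)%N & partial fbar i (theta t w) != 0]) ->
           (min_coord (fun i => (rs i)%:E)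
            < min_coord (fun i => (r T w 0 i)%R%:E))%E))).
Proof.
have fp := mean_objective_gt0 f_pos f_meas f_int.
have rg0 T w i : 0 < r T w 0 i.
  apply: (@energy_gt0 R eta (fun t => r t w 0 i) (fun t => v t w 0 i)) => //.
    by rewrite (AEGDM_r0 (run w)) sqrtr_gt0.
  by move=> t; exact: (AEGDM_r (run w)).
split.
  move=> T T1; apply: le_bigmin => [|i _]; first exact: leey.
  rewrite EFin_max ge_max; apply/andP; split; last first.
    by rewrite unlock; apply: integral_ge0 => w _; rewrite lee_fin ltW.
  have sig0 : 0 <= sigma by rewrite /sigma le_max sigma_f_ge0.
  have D30 : 0 < D3 T.
    rewrite /D3 /D3_const ltr_pwDl ?divr_gt0 ?mulr_gt0 ?sqrtr_gt0//.
    by rewrite !mulr_ge0 ?sqrtr_ge0// invr_ge0 subr_ge0 ltW.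
  (* The noise level has to be positive, while [sigma] may vanish. *)
  have bound s : sigma < s ->
    ((Num.sqrt (fbar thetas + c) - eta * D1 - mu * D2 - s * D3 T)%:E
      <= 'E_P[fun w => (r T w 0 i)%R])%E.
    move=> sig_s; have s0 : 0 < s by exact: le_lt_trans sig_s.
    have sg2 : sigma_g ^+ 2 <= s ^+ 2.
      rewrite ler_pXn2r ?nnegrE ?(ltW s0)// (le_trans _ (ltW sig_s))//.
      by rewrite /sigma le_max lexx orbT.
    have sf2 : sigma_f ^+ 2 <= s ^+ 2.
      rewrite ler_pXn2r ?nnegrE ?(ltW s0)// (le_trans _ (ltW sig_s))//.
      by rewrite /sigma le_max lexx.
    rewrite unlock.
    apply: (energy_mean_ge n_gt0 f_diff f_pos f_meas f_int xis_law xis_indep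
      fbar_diff mu_ge0 mu_lt1 eta_gt0 run s0 _ _ a_gt0 grad_bound _
      fbar_smooth thetas_min) => //.
    - move=> t; apply: filterS (grad_var t) => w; rewrite unlock => /le_trans; apply.
      by rewrite lee_fin.
    - move=> t; apply: filterS (val_var t) => w; rewrite unlock => /le_trans; apply.
      by rewrite lee_fin.
    - by apply: filterS val_bound => w vb t; have /andP[] := vb t.
  move: bound; case: ('E_P[_])%E => [y| |] bound.
  - rewrite lee_fin; apply/ler_addgt0Pr => e e0.
    have := bound (sigma + e / D3 T); rewrite ltrDl divr_gt0// => /(_ isT).
    by rewrite lee_fin mulrDl divfK ?gt_eqF//; lra.
  - exact: leey.
  - by have := bound (sigma + 1); rewrite ltrDl ltr01 => /(_ isT).
move=> fE w.
have r_ninc i : {homo (fun t => r t w 0 i) : s t / (s <= t)%N >-> t <= s}.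
  apply: (@energy_nonincreasing R eta _ (fun t => v t w 0 i)) => //=.
  by move=> t; exact: (AEGDM_r (run w)).
(* The energies decrease, so their limits are their infima. *)
pose rs i := inf (range (fun t => r t w 0 i)).
have r_lb i : has_lbound (range (fun t => r t w 0 i)).
  by exists 0 => _ [t _ <-]; rewrite ltW.
have rs_le i t : rs i <= r t w 0 i by apply: ge_inf => //; exists t.
exists rs; split => [i|D_lt].
  exact: (nonincreasing_cvgn (r_ninc i) (r_lb i)).
split.
  apply: lt_le_trans (_ : (0 <
    (Num.sqrt (fbar thetas + c) - (eta * D1 + mu * D2))%:E)%E) _.
    by rewrite lte_fin subr_gt0.
  apply: le_bigmin => [|i _]; first exact: leey.
  rewrite lee_fin; apply: lb_le_inf => [|_ [t _ <-]]; first
    by exists (r 0%N w 0 i), 0%N.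
  rewrite opprD addrA.
  exact: (noise_free_energy_ge Ginf n_gt0 f_pos eta_gt0 mu_ge0 mu_lt1 (run w)
    fbar_smooth thetas_min fE).
move=> T T1; split.
  apply: le_bigmin => [|i _]; first exact: leey.
  by apply: le_trans (bigmin_le_cond _ _ (isT : xpredT i)) _; rewrite lee_fin.
move=> [i [t [ri_min Tt dt]]].
apply: le_lt_trans (bigmin_le_cond _ _ (isT : xpredT i)) _.
apply: lt_le_trans (_ : ((rs i)%:E < (r T w 0 i)%:E)%E) _; last first.
  by apply: le_bigmin => [|j _]; [exact: leey|rewrite lee_fin].
rewrite lte_fin; apply: le_lt_trans (rs_le i t.+1) _.
apply: lt_le_trans (r_ninc i T t Tt).
rewrite -subr_gt0 -(@energy_drop R eta (fun t => r t w 0 i) (fun t => v t w 0 i))//.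
  have vt : v t w 0 i != 0.
    rewrite (AEGDM_v (run w)) (_ : f ^~ (xis t w) = fbar); last first.
      by apply/funext => y; exact: fE.
    by rewrite mulf_neq0// invr_neq0// gt_eqF// mulr_gt0// sqrtr_gt0.
  have v2 : 0 < v t w 0 i ^+ 2 by rewrite exprn_even_gt0.
  by rewrite mulr_gt0 ?(mulr_gt0 (rg0 _ _ _))// mulr_gt0.
by move=> u; exact: (AEGDM_r (run w)).
Qed.
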